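(* If $P\in\mathrm{Pos}(\mathrm{PSD}_3(\mathbb{C}),C_\square)$ satisfies $P^{\otimes k}\in\mathrm{Pos}\big(\mathrm{PSD}_3(\mathbb{C})^{\otimes_h k},C_\square^{\otimes_{\min}k}\big)$ for all $k\in\mathbb{N}$, then $P\in\mathrm{EB}(\mathrm{PSD}_3(\mathbb{C}),C_\square)$.
   Context: All vector spaces are real and finite-dimensional. A convex cone $C\subseteq V$ is proper if it is closed, pointed and generating; its dual is $C^*=\{f\in V^* : f(x)\ge 0 \text{ for all } x\in C\}$. For (proper) cones $C_1\subseteq V_1$, $C_2\subseteq V_2$, $\mathrm{Pos}(C_1,C_2)$ is the set of linear maps $P:V_1\to V_2$ with $P(C_1)\subseteq C_2$, and $\mathrm{EB}(C_1,C_2)$ (entanglement-breaking maps) is the set of linear maps that are finite sums of rank-one maps $v\mapsto f(v)x$ with $x\in C_2$, $f\in C_1^*$. The square-based cone is $C_\square=\{(x,y,z)\in\mathbb{R}^3 : |y|+|z|\le x\}$. $\mathrm{PSD}_n(\mathbb{C})$ is the cone of positive semidefinite matrices in the real vector space $\mathrm{Her}_n(\mathbb{C})$ of Hermitian $n\times n$ matrices. $\mathrm{PSD}_n(\mathbb{C})^{\otimes_h k}$ is the cone of positive semidefinite operators on $(\mathbb{C}^n)^{\otimes k}$, inside $\mathrm{Her}_n(\mathbb{C})^{\otimes k}$ identified with the Hermitian operators on $(\mathbb{C}^n)^{\otimes k}$. The maximal tensor product is $C_1\otimes_{\max}C_2=\{z\in V_1\otimes V_2 : (f_1\otimes f_2)(z)\ge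 0 \text{ for all } f_1\in C_1^*, f_2\in C_2^*\}$ and the minimal tensor product is $C_1\otimes_{\min}C_2=(C_1^*\otimes_{\max}C_2^* )^*$; these are associative and $C^{\otimes_{\min}k}$ denotes the $k$-fold minimal tensor power. *)

(* Defs.v *)
From HB Require Import structures.
From mathcomp Require Import all_boot all_order all_algebra.
From mathcomp Require Import boolp classical_sets reals.
From mathcomp Require Import complex mxtens.

Set Implicit Arguments.
Unset Strict Implicit.
Unset Printing Implicit Defensive.

Import Order.TTheory GRing.Theory Num.Theory.

Local Open Scope ring_scope.
Local Open Scope complex_scope.
Local Open Scope sesquilinear_scope.
Local Open Scope classical_set_scope.

Section Tensor.
Variable K : fieldType.
Implicit Types V W U : vectType K.

(* V (x) W is realized by coordinate matrices in the bases [vbasis fullv];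
   [tliftE] and [tlift_unique] below state its universal property. *)
Definition tensor V W : vectType K := 'M[K]_(\dim {:V}, \dim {:W}).

Definition tpure V W (v : V) (w : W) : tensor V W :=
  \matrix_(i, j) (coord (vbasis {:V}) i v * coord (vbasis {:W}) j w).

Definition tlift_fun V W U (b : V -> W -> U) (z : tensor V W) : U :=
  \sum_i \sum_j z i j *: b (vbasis {:V})`_i (vbasis {:W})`_j.

Definition tlift V W U (b : V -> W -> U) : 'Hom(tensor V W, U) :=
  linfun (tlift_fun b).

Definition tmap V W V' W' (f : 'Hom(V, V')) (g : 'Hom(W, W')) :
    'Hom(tensor V W, tensor V' W') :=
  tlift (fun v w => tpure (f v) (g w)).

Fixpoint tpow V (k : nat) : vectType K :=
  if k is k'.+1 then tensor V (tpow V k') else K^o.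

Fixpoint tpow_map V W (f : 'Hom(V, W)) (k : nat) : 'Hom(tpow V k, tpow W k) :=
  match k return 'Hom(tpow V k, tpow W k) with
  | 0 => \1%VF
  | k'.+1 => tmap f (tpow_map f k')
  end.

Fixpoint tpow_pure V (k : nat) (v : nat -> V) : tpow V k :=
  match k return tpow V k with
  | 0 => (1 : K^o)
  | k'.+1 => tpure (v 0%N) (tpow_pure k' (fun i => v i.+1))
  end.

Lemma tlift_fun_is_linear V W U (b : V -> W -> U) : linear (tlift_fun b).
Proof.
move=> a x y; rewrite /tlift_fun scaler_sumr -big_split /=.
apply: eq_bigr => i _; rewrite scaler_sumr -big_split /=.
by apply: eq_bigr => j _; rewrite !mxE scalerDl scalerA.
Qed.

HB.instance Definition _ V W U (b : V -> W -> U) :=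
  GRing.isLinear.Build K (tensor V W) U _ (tlift_fun b) (tlift_fun_is_linear b).

Lemma tliftE V W U (b : V -> W -> U) :
  (forall w, linear (fun v => b v w)) -> (forall v, linear (b v)) ->
  forall v w, tlift b (tpure v w) = b v w.
Proof.
move=> bl br v w; rewrite lfunE /= /tlift_fun.
have brs x n (c : 'I_n -> K) (y : 'I_n -> W) :
    b x (\sum_i c i *: y i) = \sum_i c i *: b x (y i).
  pose B : {linear W -> U} :=
    HB.pack (b x) (GRing.isLinear.Build K W U _ (b x) (br x)).
  rewrite -[b x]/(B : W -> U) linear_sum.
  by apply: eq_bigr => i _; rewrite linearZ.
have bls y n (c : 'I_n -> K) (x : 'I_n -> V) :
    b (\sum_i c i *: x i) y = \sum_i c i *: b (x i) y.
  pose B : {linear V -> U} :=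
    HB.pack (b^~ y) (GRing.isLinear.Build K V U _ (b^~ y) (bl y)).
  rewrite -[b _ y]/(B _) linear_sum.
  by apply: eq_bigr => i _; rewrite linearZ.
rewrite [in RHS](coord_vbasis (memvf v)) bls; apply: eq_bigr => i _.
rewrite [in RHS](coord_vbasis (memvf w)) brs scaler_sumr; apply: eq_bigr => j _.
by rewrite mxE scalerA.
Qed.

Lemma tlift_unique V W U (f g : 'Hom(tensor V W, U)) :
  (forall v w, f (tpure v w) = g (tpure v w)) -> f = g.
Proof.
move=> fg; apply/lfunP => z; rewrite [z]matrix_sum_delta !linear_sum.
apply: eq_bigr => i _; rewrite !linear_sum; apply: eq_bigr => j _.
rewrite !linearZ /=; congr (_ *: _).
suff -> : delta_mx i j = tpure (vbasis {:V})`_i (vbasis {:W})`_j by exact: fg.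
apply/matrixP => k l; rewrite !mxE !coord_free ?(basis_free (vbasisP _)) //.
by rewrite -natrM mulnb (eq_sym k) (eq_sym l).
Qed.

Lemma tpure_linearl V W (w : W) : linear (fun v : V => tpure v w).
Proof.
by move=> a x y; apply/matrixP=> i j; rewrite !mxE linearP mulrDl mulrA.
Qed.

Lemma tpure_linearr V W (v : V) : linear (fun w : W => tpure v w).
Proof.
by move=> a x y; apply/matrixP=> i j; rewrite !mxE linearP mulrDr mulrCA.
Qed.

Lemma tmapE V W V' W' (f : 'Hom(V, V')) (g : 'Hom(W, W')) v w :
  tmap f g (tpure v w) = tpure (f v) (g w).
Proof.
rewrite tliftE // => [x a y z|x a y z].
  by rewrite linearP tpure_linearl.
by rewrite linearP tpure_linearr.
Qed.

Lemma tpow_mapE V W (f : 'Hom(V, W)) k (v : nat -> V) :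
  tpow_map f k (tpow_pure k v) = tpow_pure k (fun i => f (v i)).
Proof.
elim: k v => [|k IHk] v /=; first by rewrite id_lfunE.
by rewrite tmapE IHk.
Qed.

End Tensor.

Section Cones.
Variable R : realType.
Implicit Types V W : vectType R.

Definition dual_space V : vectType R := 'Hom(V, R^o).

Definition dual_cone V (C : set V) : set (dual_space V) :=
  [set f | forall x, C x -> 0 <= f x].

Definition Pos V W (C : set V) (D : set W) : set 'Hom(V, W) :=
  [set P | forall x, C x -> D (P x)].

Definition EB V W (C : set V) (D : set W) : set 'Hom(V, W) :=
  [set P | exists (m : nat) (f : 'I_m -> dual_space V) (x : 'I_m -> W),
    (forall i, dual_cone C (f i) /\ D (x i)) /\
    (forall v, P v = \sum_i f i v *: x i)].

Definition tfun V W (f : dual_space V) (g : dual_space W) :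
    dual_space (tensor V W) :=
  tlift (fun v w => f v * g w : R^o).

Definition max_tensor V W (C : set V) (D : set W) : set (tensor V W) :=
  [set z | forall f g, dual_cone C f -> dual_cone D g -> 0 <= tfun f g z].

(* The canonical isomorphism of V (x) W with the dual of V^* (x) W^*. *)
Definition tbidual V W (z : tensor V W) :
    dual_space (tensor (dual_space V) (dual_space W)) :=
  tlift (fun f g => tfun f g z : R^o).

Definition min_tensor V W (C : set V) (D : set W) : set (tensor V W) :=
  [set z | dual_cone (max_tensor (dual_cone C) (dual_cone D)) (tbidual z)].

(* The empty power of a cone is the half-line R_{>= 0} inside R. *)
Fixpoint min_tpow V (C : set V) (k : nat) : set (tpow V k) :=
  match k return set (tpow V k) with
  | 0 => [set r : R^o | 0 <= (r : R)]
  | k'.+1 => min_tensor C (@min_tpow V C k')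
  end.

Definition square_cone : set 'rV[R]_3 :=
  [set v | `|v 0 1| + `|v 0 2%:R| <= v 0 0].

Lemma tfunE V W (f : dual_space V) (g : dual_space W) v w :
  tfun f g (tpure v w) = f v * g w.
Proof.
rewrite /tfun tliftE // => [x a y z|x a y z]; rewrite linearP.
  by rewrite mulrDl -scalerAl.
by rewrite mulrDr -scalerAr.
Qed.

Lemma tbidualE V W (z : tensor V W) (f : dual_space V) (g : dual_space W) :
  tbidual z (tpure f g) = tfun f g z.
Proof.
rewrite /tbidual tliftE // => [y a x x'|y a x x'] /=.
  have -> : tfun (a *: x + x') y = a *: tfun x y + tfun x' y.
    apply: tlift_unique => v w; rewrite !(add_lfunE, scale_lfunE, tfunE).
    by rewrite mulrDl -scalerAl.
  by rewrite add_lfunE scale_lfunE.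
have -> : tfun y (a *: x + x') = a *: tfun y x + tfun y x'.
  apply: tlift_unique => v w; rewrite !(add_lfunE, scale_lfunE, tfunE).
  by rewrite mulrDr -scalerAr.
by rewrite add_lfunE scale_lfunE.
Qed.

End Cones.

Section Hermitian.
Variable R : realType.
Local Notation C := R[i].

Section Fix.
Variable n : nat.

Record her := Her { hermx :> 'M[C]_n; _ : hermx \is hermsymmx }.

HB.instance Definition _ := [isSub for hermx].
HB.instance Definition _ := [Choice of her by <:].

Lemma hermP (A : 'M[C]_n) :
  reflect (forall i j, A i j = (A j i)^*) (A \is hermsymmx).
Proof.
apply: (iffP (is_hermitianmxP _ _ _)).
  by move=> {1}-> i j; rewrite expr0 scale1r !mxE.
by move=> AE; apply/matrixP=> i j; rewrite expr0 scale1r !mxE.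
Qed.

Lemma herE (A : her) i j : A i j = (A j i)^*.
Proof. by case: A => A /= /hermP. Qed.

Lemma her0_subproof : (0 : 'M[C]_n) \is hermsymmx.
Proof. by apply/hermP => i j; rewrite !mxE rmorph0. Qed.

Lemma herD_subproof (A B : her) : hermx A + hermx B \is hermsymmx.
Proof. by apply/hermP => i j; rewrite !mxE rmorphD /= -!herE. Qed.

Lemma herN_subproof (A : her) : - hermx A \is hermsymmx.
Proof. by apply/hermP => i j; rewrite !mxE rmorphN /= -!herE. Qed.

Lemma herZ_subproof (r : R) (A : her) : r%:C *: hermx A \is hermsymmx.
Proof.
by apply/hermP => i j; rewrite !mxE rmorphM /= -herE /= oppr0.
Qed.

Let addh A B := Her (herD_subproof A B).
Let opph A := Her (herN_subproof A).
Let scaleh r A := Her (herZ_subproof r A).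

Fact addhA : associative addh.
Proof. by move=> A B D; apply: val_inj; rewrite /= addrA. Qed.
Fact addhC : commutative addh.
Proof. by move=> A B; apply: val_inj; rewrite /= addrC. Qed.
Fact add0h : left_id (Her her0_subproof) addh.
Proof. by move=> A; apply: val_inj; rewrite /= add0r. Qed.
Fact addNh : left_inverse (Her her0_subproof) opph addh.
Proof. by move=> A; apply: val_inj; rewrite /= addNr. Qed.
HB.instance Definition _ := GRing.isZmodule.Build her addhA addhC add0h addNh.

Fact scalehA a b A : scaleh a (scaleh b A) = scaleh (a * b) A.
Proof. by apply: val_inj; rewrite /= scalerA -rmorphM. Qed.
Fact scale1h : left_id 1 scaleh.
Proof. by move=> A; apply: val_inj; rewrite /= scale1r. Qed.
Fact scalehDr : right_distributive scaleh +%R.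
Proof. by move=> a A B; apply: val_inj; rewrite /= scalerDr. Qed.
Fact scalehDl A : {morph scaleh^~ A : a b / a + b}.
Proof. by move=> a b; apply: val_inj; rewrite /= rmorphD scalerDl. Qed.
HB.instance Definition _ :=
  GRing.Zmodule_isLmodule.Build R her scalehA scale1h scalehDr scalehDl.

Lemma hermxD (A B : her) : hermx (A + B) = hermx A + hermx B.
Proof. by []. Qed.

Lemma hermxZ (r : R) (A : her) : hermx (r *: A) = r%:C *: hermx A.
Proof. by []. Qed.

(* A Hermitian A is determined by the real matrix Re A + Im A, since its real
   part is symmetric and its imaginary part antisymmetric. *)
Definition her_to_rV (A : her) : 'rV[R]_(n * n) :=
  mxvec (\matrix_(i, j) (complex.Re (A i j) + complex.Im (A i j))).

Definition rV_to_hermx (r : 'rV[R]_(n * n)) : 'M[C]_n :=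
  \matrix_(i, j) (((vec_mx r i j + vec_mx r j i) / 2%:R)
                    +i* ((vec_mx r i j - vec_mx r j i) / 2%:R)).

Lemma rV_to_her_subproof r : rV_to_hermx r \is hermsymmx.
Proof.
apply/hermP => i j; rewrite ![rV_to_hermx r _ _]mxE.
move: (vec_mx r i j) (vec_mx r j i) => x y /=.
by rewrite -mulNr opprB (addrC x y).
Qed.

Lemma her_to_rV_linear : linear her_to_rV.
Proof.
move=> a A B; rewrite /her_to_rV -linearP /=; congr mxvec.
apply/matrixP => i j; rewrite !mxE raddfD /= raddfD /=.
case: (A i j) => x y; case: (B i j) => z t /=.
by rewrite !mul0r subr0 addr0 mulrDr addrACA.
Qed.

Lemma her_to_rV_bij : bijective her_to_rV.
Proof.
exists (fun r => Her (rV_to_her_subproof r)) => [A|r].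
  apply: val_inj; apply/matrixP => i j /=.
  rewrite [LHS]mxE /her_to_rV mxvecK !mxE.
  rewrite (herE A j i); case: (A i j) => x y /=.
  have two_neq0 : (2%:R : R) != 0 by rewrite pnatr_eq0.
  congr (_ +i* _); apply: (mulIf two_neq0); rewrite divfK // mulr_natr mulr2n.
    by rewrite addrACA subrr addr0.
  by rewrite opprD opprK addrACA subrr add0r.
rewrite /her_to_rV -[RHS]vec_mxK; congr mxvec; apply/matrixP => i j.
rewrite [LHS]mxE /= [rV_to_hermx r i j]mxE /=.
move: (vec_mx r i j) (vec_mx r j i) => x y.
rewrite -mulrDl addrACA subrr addr0 -[x + x]mulr2n -[x *+ 2]mulr_natr mulfK //.
by rewrite pnatr_eq0.
Qed.

Fact her_vect_axiom : Vector.axiom (n * n) her.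
Proof. by exists her_to_rV; [exact: her_to_rV_linear|exact: her_to_rV_bij]. Qed.
HB.instance Definition _ := Lmodule_hasFinDim.Build R her her_vect_axiom.

(* In R[i], [0 <= z] says that z is a nonnegative real. *)
Definition PSD : set her :=
  [set A | forall v : 'cV[C]_n, 0 <= (v^t* *m hermx A *m v) 0 0].

End Fix.

(* hdim n k is n ^ k, in a form whose successor case is convertible to the
   dimension of a Kronecker product. *)
Fixpoint hdim (n k : nat) : nat := if k is k'.+1 then (n * hdim n k')%N else 1%N.

Lemma hdimE n k : hdim n k = (n ^ k)%N.
Proof. by elim: k => //= k ->; rewrite expnS. Qed.

Lemma hertens_subproof m n (A : her m) (B : her n) :
  hermx A *t hermx B \is hermsymmx.
Proof. by apply/hermP => i j; rewrite !mxE rmorphM /= -!herE. Qed.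

Definition hertens m n (A : her m) (B : her n) : her (m * n) :=
  Her (hertens_subproof A B).

Lemma her1_subproof (r : R) : ((r%:C)%:M : 'M[C]_1) \is hermsymmx.
Proof. by apply/hermP => i j; rewrite !mxE !ord1 /= !mulr1n /= oppr0. Qed.

Definition her1 (r : R^o) : her 1 := Her (her1_subproof r).

(* The canonical identification of Her_n (x) ... (x) Her_n with the Hermitian
   operators on C^n (x) ... (x) C^n. *)
Fixpoint tpow_her n (k : nat) : 'Hom(tpow (her n) k, her (hdim n k)) :=
  match k return 'Hom(tpow (her n) k, her (hdim n k)) with
  | 0 => linfun her1
  | k'.+1 => tlift (fun A z => hertens A (tpow_her n k' z))
  end.

Definition PSD_tpow n k : set (tpow (her n) k) :=
  [set z | PSD (tpow_her n k z)].

Lemma hertens_linearl m n (B : her n) : linear (fun A : her m => hertens A B).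
Proof.
move=> a A A'; apply: val_inj; apply/matrixP=> i j.
by rewrite /= !mxE mulrDl mulrA.
Qed.

Lemma hertens_linearr m n (A : her m) : linear (fun B : her n => hertens A B).
Proof.
move=> a B B'; apply: val_inj; apply/matrixP=> i j.
by rewrite /= !mxE mulrDr mulrCA.
Qed.

Lemma her1_linear : linear her1.
Proof.
move=> a x y; apply: val_inj; apply/matrixP=> i j.
by rewrite /= !mxE !ord1 /= !mulr1n rmorphD rmorphM.
Qed.
HB.instance Definition _ := GRing.isLinear.Build R R^o (her 1) _ her1 her1_linear.

Fixpoint hertens_seq n k (A : nat -> her n) : her (hdim n k) :=
  match k return her (hdim n k) with
  | 0 => her1 1
  | k'.+1 => hertens (A 0%N) (hertens_seq k' (fun i => A i.+1))
  end.

Lemma tpow_herE n k (A : nat -> her n) :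
  tpow_her n k (tpow_pure k A) = hertens_seq k A.
Proof.
elim: k A => [|k IHk] A /=; first by rewrite lfunE.
rewrite tliftE ?IHk // => [B|B].
  exact: hertens_linearl.
by move=> a x y; rewrite linearP hertens_linearr.
Qed.

End Hermitian.

Arguments min_tpow {R V} C k.
Arguments PSD R n : clear implicits.
Arguments PSD_tpow R n k : clear implicits.
Arguments square_cone R : clear implicits.

(* Main.v *)
From HB Require Import structures.
Require Import Defs.
From mathcomp Require Import all_boot all_order all_algebra.
From mathcomp Require Import boolp classical_sets reals.
From mathcomp Require Import topology normedtype derive.
From mathcomp Require Import complex mxtens.
From mathcomp Require Import ring lra.

(* Write the three coordinates of [P A] as [tr (X_j A)], [j = 0, 1, 2].

   Fix vectors [u], [v] and put [w_j = v* X_j u].  Applying [P^(x)k] to the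
   superpositions [u^(x)k + z v^(x)k] with [|z| = 1], and testing
   the result against the functionals [e_0^(x)k + sum_s +/- e_(s 1) (x) ... (x)
   e_(s k)], [s i] in {1, 2}, which are nonnegative on the minimal tensor power
   of the square cone, gives
     (|w_1| + |w_2|)^k <= (u* X_0 u)^k + (v* X_0 v)^k   for all k.
   After rescaling [u] and [v] this becomes
     2 (|w_1| + |w_2|) <= u* X_0 u + v* X_0 v.                            (1)

   If [P] were not entanglement breaking, a separation argument would give
   Hermitian [Z_j] with [Z_0 +/- Z_1], [Z_0 +/- Z_2] positive semidefinite and
   [sum_j tr (X_j Z_j) < 0].  By a perturbation and a congruence one may take
   [Z_0 = 1], and then [Z_1], [Z_2] to be reflections.  If [u_i] is an
   orthonormal eigenbasis of the unitary [Z_1 Z_2] and [v_i = Z_1 u_i], then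
   [sum_j tr (X_j Z_j)] is a sum over [i] of terms that are nonnegative
   by (1). *)

Set Implicit Arguments.
Unset Strict Implicit.
Unset Printing Implicit Defensive.

Import Order.TTheory GRing.Theory Num.Theory.

Local Open Scope ring_scope.
Local Open Scope complex_scope.
Local Open Scope sesquilinear_scope.
Local Open Scope classical_set_scope.

Local Notation normc := ComplexField.Normc.normc.

(** * Hermitian forms, spectral decompositions and trace inequalities *)

Section HermitianForms.
Variable C : numClosedFieldType.

Definition qform n (X : 'M[C]_n) (v u : 'cV[C]_n) : C := (v^t* *m X *m u) 0 0.

Definition psdmx n (X : 'M[C]_n) := forall v, 0 <= qform X v v.

Lemma trmxC_mul m n p (A : 'M[C]_(m, n)) (B : 'M[C]_(n, p)) :
  (A *m B)^t* = B^t* *m A^t*.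
Proof. by rewrite trmx_mul map_mxM. Qed.

Lemma trmxCD m n (A B : 'M[C]_(m, n)) : (A + B)^t* = A^t* + B^t*.
Proof. by rewrite linearD /= map_mxD. Qed.

Lemma trmxCZ m n a (A : 'M[C]_(m, n)) : (a *: A)^t* = Num.conj a *: A^t*.
Proof. by rewrite linearZ /= map_mxZ. Qed.

Lemma hermsymE n (A : 'M[C]_n) : A \is hermsymmx -> A^t* = A.
Proof. by move/is_hermitianmxP; rewrite expr0 scale1r. Qed.

Lemma hermsymP n (A : 'M[C]_n) : A^t* = A -> A \is hermsymmx.
Proof. by move=> hA; apply/is_hermitianmxP; rewrite expr0 scale1r hA. Qed.

Lemma qform_congr n (S X : 'M[C]_n) v u :
  qform (S^t* *m X *m S) v u = qform X (S *m v) (S *m u).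
Proof. by rewrite /qform trmxC_mul !mulmxA. Qed.

Lemma qform_tr n (X : 'M[C]_n) v u : qform X v u = \tr (X *m (u *m v^t*)).
Proof. by rewrite mulmxA mxtrace_mulC mulmxA /mxtrace big_ord1. Qed.

Lemma qformD n (X Y : 'M[C]_n) v u : qform (X + Y) v u = qform X v u + qform Y v u.
Proof. by rewrite /qform mulmxDr mulmxDl mxE. Qed.

Lemma conj_qform n (X : 'M[C]_n) v u :
  X^t* = X -> Num.conj (qform X v u) = qform X u v.
Proof.
move=> hX.
have -> : Num.conj (qform X v u) = ((v^t* *m X *m u)^t*) 0 0.
  by rewrite [RHS]mxE; congr Num.conj; rewrite mxE.
by rewrite !trmxC_mul hX trmxCK mulmxA.
Qed.

Lemma qform_delta n (X : 'M[C]_n) i j :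
  qform X (delta_mx i 0) (delta_mx j 0) = X i j.
Proof.
rewrite /qform trmx_delta.
have -> : map_mx (@Num.conj C) (delta_mx 0 i : 'rV_n) = delta_mx 0 i.
  by apply/matrixP => a b; rewrite !mxE; case: (_ && _); rewrite ?rmorph1 ?rmorph0.
by rewrite -rowE -colE !mxE.
Qed.

Lemma qformZr n (X : 'M[C]_n) a v u : qform X v (a *: u) = a * qform X v u.
Proof. by rewrite /qform -scalemxAr mxE. Qed.

Lemma qformZl n (X : 'M[C]_n) a v u : qform X (a *: v) u = Num.conj a * qform X v u.
Proof.
by rewrite /qform linearZ /= map_mxZ -!scalemxAl mxE.
Qed.

Lemma tr_qform n (X U : 'M[C]_n) : U \is unitarymx ->
  \tr X = \sum_i qform X (col i U) (col i U).
Proof.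
move=> /unitarymxP UU.
rewrite -[in LHS](mulmx1 X) -UU mulmxA mxtrace_mulC mulmxA.
by apply: eq_bigr => i _; rewrite -qform_delta qform_congr -colE.
Qed.

Lemma mxtrace_diag_mul n (d : 'rV[C]_n) (X : 'M[C]_n) :
  \tr (diag_mx d *m X) = \sum_i d 0 i * X i i.
Proof. by rewrite mul_diag_mx; apply: eq_bigr => i _; rewrite mxE. Qed.

Lemma spectralE n (X : 'M[C]_n) : X \is normalmx ->
  X = (spectralmx X)^t* *m diag_mx (spectral_diag X) *m spectralmx X.
Proof.
by move=> /orthomx_spectralP; rewrite invmx_unitary // spectral_unitarymx.
Qed.

(* Opposite signs on the eigenspaces of [X] minimize the trace pairing. *)
Lemma reflection_le n (X Y : 'M[C]_n) :
  X \is hermsymmx -> psdmx (1%:M + Y) -> psdmx (1%:M - Y) ->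
  exists D : 'M[C]_n,
    [/\ D^t* = D, D *m D = 1%:M & \tr (X *m D) <= \tr (X *m Y)].
Proof.
move=> hX pY mY; have nX := hermitian_normalmx hX.
have dreal i : spectral_diag X 0 i \is Num.real.
  by have /mxOverP := hermitian_spectral_diag_real hX; apply.
set U := spectralmx X; set d := spectral_diag X.
have uU : U \is unitarymx := spectral_unitarymx X.
have UU : U *m U^t* = 1%:M by exact/unitarymxP.
have UU' : U^t* *m U = 1%:M by rewrite (mulmx1C UU).
have trE Z : \tr (X *m (U^t* *m Z *m U)) = \sum_i d 0 i * Z i i.
  rewrite -mxtrace_diag_mul {1}(spectralE nX) -/U -/d.
  by rewrite !mulmxA mxtrace_mulC !mulmxA UU mul1mx -(mulmxA _ U) UU mulmx1.
pose s : 'rV[C]_n := \row_i - (-1) ^+ (d 0 i < 0)%R.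
exists (U^t* *m diag_mx s *m U); split.
- rewrite !trmxC_mul trmxCK mulmxA; congr (_ *m _ *m _).
  apply/matrixP => i j; rewrite !mxE eq_sym; case: eqP => [->|_].
    by rewrite !mulr1n rmorphN rmorph_sign.
  by rewrite rmorph0.
- rewrite -!mulmxA (mulmxA U) UU mul1mx (mulmxA (diag_mx s)).
  rewrite (_ : diag_mx s *m _ = 1%:M) ?mul1mx //.
  rewrite mulmx_diag -diag_const_mx; congr diag_mx.
  by apply/rowP => i; rewrite !mxE mulrNN -expr2 sqrr_sign.
have -> : Y = U^t* *m (U *m Y *m U^t*) *m U.
  by rewrite !mulmxA UU' mul1mx -mulmxA UU' mulmx1.
rewrite !trE; apply: ler_sum => i _.
rewrite !mxE eqxx mulr1n.
set y := (X in _ <= _ * X).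
(* In the eigenbasis of [X], the hypotheses on [Y] say [-1 <= y <= 1] for each diagonal entry
   [y]. *)
have yE Z : (U *m Z *m U^t*) i i =
    qform Z (U^t* *m delta_mx i 0) (U^t* *m delta_mx i 0).
  by rewrite -qform_congr trmxCK qform_delta.
have y1 : 0 <= 1 + y.
  have := pY (U^t* *m delta_mx i 0).
  by rewrite -yE mulmxDr mulmxDl mulmx1 UU !mxE eqxx.
have y2 : 0 <= 1 - y.
  have := mY (U^t* *m delta_mx i 0).
  by rewrite -yE mulmxBr mulmxBl mulmx1 UU !mxE eqxx.
case: real_ltP (dreal i) => // [di|di] _.
  by rewrite expr1 opprK mulr1 -subr_ge0 -[X in _ - X]mulr1 -mulrBr nmulr_rge0 //
    -oppr_ge0 opprB.
by rewrite expr0 mulrN1 -subr_ge0 opprK -[X in _ + X]mulr1 -mulrDr mulr_ge0 //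
  addrC.
Qed.

(** This is inequality (1), required for all pairs of vectors and therefore stable under
    congruence. *)
Definition offdiag_dominated n (X0 X1 X2 : 'M[C]_n) := forall u v : 'cV[C]_n,
  (`|qform X1 v u| + `|qform X2 v u|) *+ 2 <= qform X0 u u + qform X0 v v.

Lemma offdiag_dominated_congr n (S X0 X1 X2 : 'M[C]_n) :
  offdiag_dominated X0 X1 X2 ->
  offdiag_dominated (S^t* *m X0 *m S) (S^t* *m X1 *m S) (S^t* *m X2 *m S).
Proof. by move=> st u v; rewrite !qform_congr. Qed.

(* With an orthonormal eigenbasis [D1 D2 u_i = mu_i u_i] and [v_i = D1 u_i],
   the vectors [v_i] are orthonormal too, [D1 u_i = v_i] and
   [D2 u_i = mu_i v_i]. *)
Lemma offdiag_dominated_reflections n (X0 X1 X2 D1 D2 : 'M[C]_n) :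
  X0 \is hermsymmx -> X1 \is hermsymmx -> X2 \is hermsymmx ->
  offdiag_dominated X0 X1 X2 ->
  D1^t* = D1 -> D1 *m D1 = 1%:M -> D2^t* = D2 -> D2 *m D2 = 1%:M ->
  0 <= 'Re (\tr X0 + \tr (X1 *m D1) + \tr (X2 *m D2)).
Proof.
move=> h0 h1 h2 st hD1 DD1 hD2 DD2.
pose W := D1 *m D2.
have nW : W \is normalmx.
  apply/normalmxP; rewrite /W trmxC_mul hD1 hD2.
  by rewrite mulmxA -(mulmxA D1) DD2 mulmx1 DD1 mulmxA -(mulmxA D2) DD1 mulmx1 DD2.
pose U := (spectralmx W)^t*; pose mu := spectral_diag W.
have uU : U \is unitarymx by rewrite trmxC_unitary spectral_unitarymx.
have U'U : U^t* *m U = 1%:M by apply: mulmx1C; exact/unitarymxP.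
have WE i : W *m col i U = mu 0 i *: col i U.
  rewrite (spectralE nW) -/U -/mu -[spectralmx W]trmxCK -/U.
  rewrite -(mulmxA (U *m _)) colE [U^t* *m _]mulmxA.
  rewrite U'U mul1mx -mulmxA scalemxAr; congr (_ *m _).
  apply/matrixP => a b; rewrite mul_diag_mx !mxE.
  by case: eqP => [->|_]; rewrite ?mulr1 ?mulr0.
have WW : W^t* *m W = 1%:M.
  by rewrite /W trmxC_mul hD1 hD2 -mulmxA (mulmxA D1) DD1 mul1mx.
have D2E : D2 = D1 *m W by rewrite /W mulmxA DD1 mul1mx.
have mu1 i : `|mu 0 i| = 1.
  have q1 : qform 1%:M (col i U) (col i U) = 1.
    by rewrite colE -qform_congr qform_delta mulmx1 U'U mxE eqxx.
  have qW : qform 1%:M (W *m col i U) (W *m col i U) = 1.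
    by rewrite -qform_congr mulmx1 WW.
  have : `|mu 0 i| ^+ 2 = 1.
    by rewrite normCK -[RHS]qW WE qformZl qformZr q1 mulr1 mulrC.
  by move/eqP; rewrite sqrp_eq1 // => /eqP.
pose v i := D1 *m col i U.
have trD : \tr (D1^t* *m X0 *m D1) = \tr X0.
  by rewrite mxtrace_mulC mulmxA hD1 DD1 mul1mx.
have vE X i : qform X (col i U) (v i) = qform (X *m D1) (col i U) (col i U).
  by rewrite /qform !mulmxA.
have muE i : mu 0 i * qform X2 (col i U) (v i) =
    qform (X2 *m D2) (col i U) (col i U).
  by rewrite -qformZr D2E /v scalemxAr -WE /qform !mulmxA.
(* The [col i U] and the [v i] both form orthonormal bases, so [tr X0] is the mean of the two sums
   of diagonal values of [X0]. *)
have -> : \tr X0 + \tr (X1 *m D1) + \tr (X2 *m D2) =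
  \sum_i ((qform X0 (col i U) (col i U) + qform X0 (v i) (v i)) / 2
     + qform X1 (col i U) (v i) + mu 0 i * qform X2 (col i U) (v i)).
  rewrite !big_split /= -mulr_suml big_split /=.
  rewrite (eq_bigr _ (fun i _ => vE X1 i)) (eq_bigr _ (fun i _ => muE i)).
  rewrite (eq_bigr _ (fun i _ => esym (qform_congr D1 X0 (col i U) (col i U)))).
  rewrite -!tr_qform // trD.
  by rewrite -mulr2n -(mulr_natr (\tr X0)) mulfK ?pnatr_eq0.
rewrite raddf_sum /=; apply: sumr_ge0 => i _.
rewrite !raddfD /=.
have ReE : 'Re ((qform X0 (col i U) (col i U) + qform X0 (v i) (v i)) / 2)
           = (qform X0 (col i U) (col i U) + qform X0 (v i) (v i)) / 2.
  apply/Creal_ReP/CrealP; rewrite rmorphM rmorphD fmorphV /= conjC_nat.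
  by rewrite !conj_qform ?hermsymE.
rewrite ReE.
(* Bounding real parts below by minus the modulus, where [mu 0 i] drops out, leaves an instance of
   (1). *)
have le_Re (z : C) : - `|z| <= 'Re z.
  by rewrite lerNl -raddfN -normrN; case: (leif_Re_Creal (- z)).
apply: le_trans (lerD (lerD (lexx _) (le_Re _)) (le_Re _)).
rewrite normrM mu1 mul1r -addrA -opprD subr_ge0 ler_pdivlMr ?ltr0n //.
by rewrite mulr_natr [X in _ <= X]addrC st.
Qed.

Lemma Re_le (x y : C) : x <= y -> 'Re x <= 'Re y.
Proof.
rewrite -subr_ge0 => xy; rewrite -subr_ge0 -raddfB /=.
by move/ger0_real: (xy) => /Creal_ReP ->.
Qed.

(** In a spectral decomposition of [Z] with unitary [U] and eigenvalues [d], take [S] to be the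
    adjoint of [U] times [diag (sqrt d)]; it is invertible because every eigenvalue is positive. *)
Lemma posdef_factor n (Z : 'M[C]_n) : Z \is hermsymmx ->
  (forall v, v != 0 -> 0 < qform Z v v) ->
  exists2 S : 'M[C]_n, S \in unitmx & Z = S *m S^t*.
Proof.
move=> hZ pZ; have ZE := spectralE (hermitian_normalmx hZ).
set U := spectralmx Z in ZE; set d := spectral_diag Z in ZE.
have UU : U *m U^t* = 1%:M by apply/unitarymxP; exact: spectral_unitarymx.
have d_gt0 i : 0 < d 0 i.
  have -> : d 0 i = qform Z (U^t* *m delta_mx i 0) (U^t* *m delta_mx i 0).
    rewrite -qform_congr trmxCK qform_delta {1}ZE !mulmxA UU mul1mx.
    by rewrite -mulmxA UU mulmx1 mxE eqxx.
  apply: pZ; apply/eqP => /(congr1 (mulmx U)).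
  rewrite mulmxA UU mul1mx mulmx0 => /matrixP /(_ i 0) /eqP.
  by rewrite !mxE !eqxx oner_eq0.
pose s : 'rV[C]_n := \row_i sqrtC (d 0 i).
exists (U^t* *m diag_mx s).
  rewrite unitmx_mul unitarymx_unit ?trmxC_unitary ?spectral_unitarymx //=.
  rewrite unitmxE det_diag unitfE; apply/prodf_neq0 => i _.
  by rewrite mxE sqrtC_eq0 gt_eqF.
rewrite trmxC_mul trmxCK ZE mulmxA; congr (_ *m _).
rewrite -mulmxA; congr (_ *m _).
have -> : (diag_mx s)^t* = diag_mx s.
  apply/matrixP => i j; rewrite !mxE eq_sym.
  case: eqP => [->|_]; last by rewrite rmorph0.
  by rewrite !mulr1n geC0_conj // sqrtC_ge0 ltW.
rewrite mulmx_diag; congr diag_mx; apply/rowP => i.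
by rewrite !mxE -expr2 sqrtCK.
Qed.

(** With [Z0 = S S*] and [T] the inverse of [S], passing to [S* X_j S] and [T Z_j T*] keeps the
    traces and turns [Z0] into the identity. Then [reflection_le] exchanges [Z1] and [Z2] for
    reflections without increasing the traces. *)
Lemma offdiag_dominated_trace_ge0 n (X0 X1 X2 Z0 Z1 Z2 : 'M[C]_n) :
  X0 \is hermsymmx -> X1 \is hermsymmx -> X2 \is hermsymmx ->
  offdiag_dominated X0 X1 X2 ->
  Z0 \is hermsymmx -> (forall v, v != 0 -> 0 < qform Z0 v v) ->
  psdmx (Z0 + Z1) -> psdmx (Z0 - Z1) -> psdmx (Z0 + Z2) -> psdmx (Z0 - Z2) ->
  0 <= 'Re (\tr (X0 *m Z0) + \tr (X1 *m Z1) + \tr (X2 *m Z2)).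
Proof.
move=> h0 h1 h2 st hZ0 pZ0 p1 m1 p2 m2.
have [S uS ZE] := posdef_factor hZ0 pZ0.
pose T := invmx S.
have ST : S *m T = 1%:M by rewrite mulmxV.
have TS : T *m S = 1%:M by rewrite mulVmx.
have TS' : T^t* *m S^t* = 1%:M.
  by rewrite -trmxC_mul ST trmx1 map_mx1.
have TZT : T *m Z0 *m T^t* = 1%:M.
  by rewrite ZE !mulmxA TS mul1mx (mulmx1C TS').
have herm_congr X : X \is hermsymmx -> S^t* *m X *m S \is hermsymmx.
  by move=> hX; apply: hermsymP; rewrite !trmxC_mul trmxCK (hermsymE hX) // mulmxA.
have refl X Z : X \is hermsymmx -> psdmx (Z0 + Z) -> psdmx (Z0 - Z) ->
    exists D : 'M[C]_n, [/\ D^t* = D, D *m D = 1%:M &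
      \tr ((S^t* *m X *m S) *m D) <= \tr (X *m Z)].
  move=> hX pZ mZ.
  have [| |D [hD DD le]] :=
      @reflection_le n (S^t* *m X *m S) (T *m Z *m T^t*) (herm_congr _ hX).
  - move=> v; have := pZ (T^t* *m v); rewrite -qform_congr trmxCK.
    by rewrite mulmxDr mulmxDl TZT.
  - move=> v; have := mZ (T^t* *m v); rewrite -qform_congr trmxCK.
    by rewrite mulmxBr mulmxBl TZT.
  exists D; split=> //; apply: le_trans le _.
  rewrite !mulmxA -(mulmxA _ S T) ST mulmx1 [leLHS]mxtrace_mulC !mulmxA.
  by rewrite TS' mul1mx.
have [D1 [hD1 DD1 le1]] := refl _ _ h1 p1 m1.
have [D2 [hD2 DD2 le2]] := refl _ _ h2 p2 m2.
have := offdiag_dominated_reflections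
  (herm_congr _ h0) (herm_congr _ h1) (herm_congr _ h2)
  (offdiag_dominated_congr S st) hD1 DD1 hD2 DD2.
move/le_trans; apply; apply: Re_le; apply: lerD le2; apply: lerD le1.
by rewrite ZE mulmxA [leRHS]mxtrace_mulC !mulmxA.
Qed.
End HermitianForms.

(** * A Farkas alternative obtained from least squares *)

Section LeastSquares.
Import numFieldNormedType.Exports.
Variable R : realType.

Definition ip m n (A B : 'M[R]_(m, n)) : R := \sum_i \sum_j A i j * B i j.

Lemma ipC m n (A B : 'M[R]_(m, n)) : ip A B = ip B A.
Proof. by apply: eq_bigr => i _; apply: eq_bigr => j _; rewrite mulrC. Qed.

Lemma ipDl m n (A B D : 'M[R]_(m, n)) : ip (A + B) D = ip A D + ip B D.
Proof.
rewrite -big_split; apply: eq_bigr => i _; rewrite -big_split.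
by apply: eq_bigr => j _; rewrite mxE mulrDl.
Qed.

Lemma ipZl m n a (A B : 'M[R]_(m, n)) : ip (a *: A) B = a * ip A B.
Proof.
rewrite mulr_sumr; apply: eq_bigr => i _; rewrite mulr_sumr.
by apply: eq_bigr => j _; rewrite mxE mulrA.
Qed.

Lemma ipDr m n (A B D : 'M[R]_(m, n)) : ip D (A + B) = ip D A + ip D B.
Proof. by rewrite !(ipC D) ipDl. Qed.

Lemma ipZr m n a (A B : 'M[R]_(m, n)) : ip A (a *: B) = a * ip A B.
Proof. by rewrite !(ipC A) ipZl. Qed.

Lemma ip_ge0 m n (A : 'M[R]_(m, n)) : 0 <= ip A A.
Proof. by do 2![apply: sumr_ge0 => ? _]; rewrite -expr2 sqr_ge0. Qed.

Lemma sqr_le_ip m n (A : 'M[R]_(m, n)) i j : A i j ^+ 2 <= ip A A.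
Proof.
rewrite /ip (bigD1 i) //= (bigD1 j) //= -expr2 -addrA lerDl.
by apply: addr_ge0; do ?[apply: sumr_ge0 => ? _]; rewrite -expr2 sqr_ge0.
Qed.

Lemma ip_eq0 m n (A : 'M[R]_(m, n)) : ip A A <= 0 -> A = 0.
Proof.
move=> A0; apply/matrixP => i j; rewrite mxE; apply/eqP.
by rewrite -sqrf_eq0 eq_le sqr_ge0 andbT (le_trans (sqr_le_ip A i j)).
Qed.

(** An [m]-tuple in the dual cone of [K], stored as one matrix so that [Phi *m s] forms its linear
    combinations. *)
Definition dual_rows N (K : set 'rV[R]_N) m : set 'M[R]_(m, N) :=
  [set s | forall i r, K r -> 0 <= ip (row i s) r].

Arguments dual_rows {N} K m _.

(** The limit [t -> 0], used both for first-order optimality and to remove a perturbation. *)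
Lemma nonneg_limit (a b : R) :
  (forall t, 0 < t < 1 -> 0 <= a + t * b) -> 0 <= a.
Proof.
move=> H; rewrite leNgt; apply/negP => a0.
(* Chosen so that [t * b <= - a / 2], whence [a + t * b <= a / 2 < 0]. *)
pose t := - a / (1 - a + `|b|) / 2.
have D0 : 0 < 1 - a + `|b| by rewrite ltr_wpDr // subr_gt0 (lt_trans a0).
have t0 : 0 < t by rewrite !divr_gt0 ?oppr_gt0.
have tE : t * (1 - a + `|b|) = - a / 2.
  by rewrite /t mulrAC divfK // gt_eqF.
have t1 : t < 1.
  rewrite -(ltr_pM2r D0) tE mul1r.
  rewrite ltr_pdivrMr //; have := normr_ge0 b; lra.
have := H t; rewrite t0 t1 => /(_ isT).
have : t * b <= t * (1 - a + `|b|).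
  by apply: ler_wpM2l; [exact: ltW|have := ler_norm b; lra].
by rewrite tE; lra.
Qed.

Lemma continuous_entry m n i j :
  continuous (fun v : 'rV[R]_(m * n) => vec_mx v i j).
Proof.
have -> : (fun v : 'rV[R]_(m * n) => vec_mx v i j) =
    (fun v => v 0 (mxvec_index i j)).
  by apply/funext => v; rewrite mxE.
exact: coord_continuous.
Qed.

Lemma continuous_sum (T : topologicalType) (I : Type) (r : seq I)
    (F : I -> T -> R) :
  (forall i, continuous (F i)) -> continuous (fun x => \sum_(i <- r) F i x).
Proof. by move=> cF; apply: continuous_big => //; exact: add_continuous. Qed.

Lemma continuous_mul_cst (T : topologicalType) (f : T -> R) (c : R) :
  continuous f -> continuous (fun x => f x * c).
Proof. by move=> cf x; apply: cvgMl; exact: cf. Qed.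

Lemma continuous_add_cst (T : topologicalType) (f : T -> R) (c : R) :
  continuous f -> continuous (fun x => f x + c).
Proof. by move=> cf x; apply: cvgD; [exact: cf|exact: cvg_cst]. Qed.

Lemma continuous_mul (T : topologicalType) (f g : T -> R) :
  continuous f -> continuous g -> continuous (fun x => f x * g x).
Proof. by move=> cf cg x; apply: cvgM; [exact: cf|exact: cg]. Qed.

(* A least-squares approximation [Phi s] of [x] exists by compactness; the
   residual is then the separating functional. *)
Lemma farkas_dual_rows N m p (K : set 'rV[R]_N) (Phi : 'M[R]_(p, m)) i0
    (x : 'M[R]_(p, N)) :
  (forall r, exists p q, [/\ K p, K q & r = p - q]) ->
  (forall j, Phi i0 j = 1) ->
  (exists2 s, dual_rows K m s & x = Phi *m s) \/
  (exists2 Z : 'M[R]_(p, N), ip Z x < 0 &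
     forall s, dual_rows K m s -> 0 <= ip Z (Phi *m s)).
Proof.
move=> genK Phi1.
pose Q := dual_rows K m.
pose f s := ip (Phi *m s - x) (Phi *m s - x).
have f_cont : continuous (fun v : 'rV[R]_(m * N) => f (vec_mx v)).
  rewrite /f /ip; apply: continuous_sum => i.
  apply: continuous_sum => j.
  have cE : continuous (fun v : 'rV[R]_(m * N) => (Phi *m vec_mx v - x) i j).
    have -> : (fun v : 'rV[R]_(m * N) => (Phi *m vec_mx v - x) i j) =
        (fun v => \sum_k vec_mx v k j * Phi i k + (- x i j)).
      apply/funext => v; rewrite !mxE; congr (_ + _).
      by apply: eq_bigr => k _; rewrite mulrC.
    apply: continuous_add_cst; apply: continuous_sum => k; apply: continuous_mul_cst.
    exact: continuous_entry.
  by apply: continuous_mul; exact: cE.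
have Q0 : Q 0.
  move=> i r _; suff -> : ip (row i 0) r = 0 by [].
  by rewrite row0 -(scale0r (0 : 'rV_N)) ipZl mul0r.
pose A := [set v : 'rV[R]_(m * N) | Q (vec_mx v) /\ f (vec_mx v) <= f 0].
have A0 : A !=set0.
  by exists 0; split; rewrite linear0.
have closedA : closed A.
  have -> : A = (\bigcap_(ir in [set ir : 'I_m * 'rV[R]_N | K ir.2])
       (fun v : 'rV[R]_(m * N) => ip (row ir.1 (vec_mx v)) ir.2) @^-1` [set y | 0 <= y])
      `&` (fun v => f (vec_mx v)) @^-1` [set y | y <= f 0].
    apply/seteqP; split=> v [qv fv]; split=> //.
      by move=> [i r] /= Kr; exact: qv.
    by move=> i r Kr; exact: (qv (i, r)).
  apply: closedI; last by apply: preimage_closed; [exact: in1W|exact: closed_le].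
  apply: closed_bigI => -[i r] /= Kr.
  apply: preimage_closed; last exact: closed_ge.
  apply: in1W; rewrite /ip /=.
  apply: continuous_sum => j; apply: continuous_sum => k; apply: continuous_mul_cst.
  have -> : (fun v : 'rV[R]_(m * N) => row i (vec_mx v) j k) = (fun v => vec_mx v i k).
    by apply/funext => v; rewrite mxE.
  exact: continuous_entry.
(* Row [i0] of [Phi *m s] is the sum of the rows of [s]. Each row is nonnegative on [K], so bounding
   the sum on [K] bounds every row there, and differences of elements of [K] reach all
   coordinates. *)
have [c boundA] : exists c, forall v, A v -> forall i, `[- c, c]%classic (v ord0 i).
  have /choice[g gP] k : exists g : 'rV[R]_N * 'rV[R]_N,
      [/\ K g.1, K g.2 & delta_mx 0 k = g.1 - g.2].
    by have [a [b ?]] := genK (delta_mx 0 k); exists (a, b).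
  (* A residual entry [y] has [y ^+ 2 <= f 0], hence modulus at most [1 + f 0]; so [b l] bounds
     entry [l] of row [i0] of [Phi *m s]. *)
  pose b l := 1 + f 0 + `|x i0 l|.
  have b_ge0 l : 0 <= b l by rewrite !addr_ge0 // ip_ge0.
  pose c k := \sum_l b l * `|((g k).1 + (g k).2) 0 l|.
  have c_ge0 k : 0 <= c k by apply: sumr_ge0 => l _; rewrite mulr_ge0.
  exists (\sum_k c k) => v [Qv fv] i; rewrite /= in_itv /= -ler_norml.
  case/mxvec_indexP: i => j k.
  apply: (@le_trans _ _ (c k)); last first.
    by rewrite (bigD1 k) //= lerDl sumr_ge0.
  set s := vec_mx v in Qv fv.
  have -> : v ord0 (mxvec_index j k) = s j k by rewrite mxE.
  have [Kp Kq dE] := gP k.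
  have -> : s j k = ip (row j s) (g k).1 - ip (row j s) (g k).2.
    rewrite -[RHS]addrC -mulN1r -ipZr -ipDr scaleN1r addrC -dE /ip big_ord1.
    rewrite (bigD1 k) //= big1 ?addr0 => [|l lk]; rewrite !mxE ?eqxx ?mulr1 //.
    by rewrite (negPf lk) mulr0.
  have p0 := Qv j _ Kp; have q0 := Qv j _ Kq.
  apply: (le_trans (ler_normB _ _)); rewrite !ger0_norm // -ipDr.
  have -> : c k = ip (\row_l b l) (\row_l `|((g k).1 + (g k).2) 0 l|).
    by rewrite /ip big_ord1; apply: eq_bigr => l _; rewrite !mxE.
  apply: (@le_trans _ _ (ip (row i0 (Phi *m s)) ((g k).1 + (g k).2))).
    have -> : row i0 (Phi *m s) = \sum_j row j s.
      apply/rowP => l; rewrite summxE !mxE; apply: eq_bigr => j' _.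
      by rewrite Phi1 mul1r [RHS]mxE.
    rewrite (bigD1 j) //= ipDl lerDl.
    elim/big_rec: _ => [|j' y _ y0].
      by rewrite -(scale0r (0 : 'rV_N)) ipZl mul0r.
    by rewrite ipDl addr_ge0 // ipDr addr_ge0 ?Qv.
  rewrite /ip !big_ord1; apply: ler_sum => l _.
  rewrite [X in _ <= X * _]mxE [X in _ <= _ * X]mxE.
  apply: (le_trans (ler_norm _)); rewrite normrM; apply: ler_wpM2r => //.
  rewrite [X in `|X|]mxE /b -[X in `|X|](subrK (x i0 l)).
  apply: (le_trans (ler_normD _ _)); rewrite lerD2r.
  set y := _ - _.
  have : y ^+ 2 <= f 0.
    have -> : y = (Phi *m s - x) i0 l by rewrite [RHS]mxE [X in _ = _ + X]mxE.
    exact: le_trans (sqr_le_ip _ _ _) fv.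
  by rewrite -real_normK ?num_real //; have := normr_ge0 y; nra.
have compA : compact A.
  apply: (@subclosed_compact _ _
    [set v : 'rV[R]_(m * N) | forall i, `[- c, c]%classic (v ord0 i)]) => //.
  apply: (@rV_compact _  _ (fun=> `[- c, c]%classic)).
  by move=> _; apply: segment_compact.
have [|v0] := @EVT_min_rV R _ (fun v => f (vec_mx v)) A A0 compA.
  by apply: continuous_subspaceT.
rewrite inE => -[Qs _] minf.
set s := vec_mx v0 in Qs minf.
(* Outside the sublevel set [A] the value exceeds [f 0], so the minimum over [A] is one over all of
   [Q]. *)
have {}minf s' : Q s' -> f s <= f s'.
  move=> Qs'; have [fs'|fs'] := leP (f s') (f 0).
    have := minf (mxvec s'); rewrite mxvecK; apply.
    by rewrite inE; split; rewrite mxvecK.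
  apply: (le_trans _ (ltW fs')); have := minf 0; rewrite linear0; apply.
  by rewrite inE; split; rewrite linear0.
pose Z := Phi *m s - x.
(* First-order optimality in every admissible direction: expand [f (s + t *: h)], divide by [t] and
   let [t] tend to 0. *)
have opt h : (forall t, 0 < t < 1 -> Q (s + t *: h)) -> 0 <= ip Z (Phi *m h).
  move=> Qh; rewrite -(pmulr_rge0 _ (ltr0n _ 2)).
  apply: (@nonneg_limit _ (ip (Phi *m h) (Phi *m h))) => t t01.
  have t0 : 0 < t by case/andP: t01.
  have := minf _ (Qh t t01); rewrite /f mulmxDr -scalemxAr addrAC -/Z.
  move: Z (Phi *m h) => z w.
  rewrite (ipDl z) !ipDr !ipZl !ipZr (ipC w z) => le_zw.
  by rewrite -(pmulr_rge0 _ t0); lra.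
have QD s1 s2 a : 0 <= a -> Q s1 -> Q s2 -> Q (s1 + a *: s2).
  move=> a0 Q1 Q2 i r Kr; rewrite linearD linearZ /= ipDl ipZl.
  by rewrite addr_ge0 ?mulr_ge0 ?Q1 ?Q2.
have ZQ s' : Q s' -> 0 <= ip Z (Phi *m s').
  by move=> Qs'; apply: opt => t /andP[t0 _]; apply: QD => //; exact: ltW.
have [Z0|] := leP (ip Z Z) 0.
  left; exists s => //; apply/eqP; rewrite eq_sym -subr_eq0; apply/eqP.
  exact: ip_eq0.
move=> ZZ; right; exists Z => //.
(* The direction [- s] is admissible since [(1 - t) *: s] stays in [Q]. Hence
   [ip Z (Phi *m s) <= 0], and [x = Phi *m s - Z] gives [ip Z x <= - ip Z Z < 0]. *)
have : 0 <= ip Z (Phi *m (- s)).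
  apply: opt => t /andP[_ t1]; rewrite -[s in s + _]scale1r scalerN -scalerBl.
  by rewrite -[_ *: s]add0r; apply: QD => //; rewrite subr_ge0 ltW.
have -> : x = Phi *m s + (-1) *: Z by rewrite scaleN1r /Z opprB addrC subrK.
by rewrite mulmxN -scaleN1r ipDr !ipZr; lra.
Qed.
End LeastSquares.

(** * Positive functionals on minimal tensor powers and the inequality between [k]-th powers *)

Section TensorFunctionals.
Variable R : realType.
Implicit Types V W : vectType R.

Lemma tfunNr V W (f : dual_space V) (g : dual_space W) :
  tfun f (- g) = - tfun f g.
Proof.
by apply: tlift_unique => v w; rewrite opp_lfunE !tfunE opp_lfunE mulrN.
Qed.

Fixpoint tfun_pow V (f : dual_space V) (k : nat) : dual_space (tpow V k) :=
  match k return dual_space (tpow V k) with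
  | 0 => \1%VF
  | k'.+1 => tfun f (tfun_pow f k')
  end.

(* [correlators e1 e2 k] is the set of the sums of all products
   [e_(s 1) (x) ... (x) e_(s k)], [s i] in {1, 2}, with arbitrary signs. *)
Fixpoint correlators V (e1 e2 : dual_space V) (k : nat) :
    set (dual_space (tpow V k)) :=
  match k return set (dual_space (tpow V k)) with
  | 0 => [set g | g = \1%VF \/ g = - \1%VF]
  | k'.+1 => [set g | exists g1 g2, [/\ @correlators V e1 e2 k' g1,
       @correlators V e1 e2 k' g2 & g = tfun e1 g1 + tfun e2 g2]]
  end.

Arguments correlators {V} e1 e2 k _.

Lemma correlatorsN V (e1 e2 : dual_space V) k g :
  correlators e1 e2 k g -> correlators e1 e2 k (- g).
Proof.
elim: k g => [|k IHk] g /=; first by case=> ->; [right|left; rewrite opprK].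
move=> [g1 [g2 [Eg1 Eg2 ->]]]; exists (- g1), (- g2).
by split; [exact: IHk|exact: IHk|rewrite !tfunNr opprD].
Qed.

(** By induction [e0^(x)k + h] and [e0^(x)k - h] are both positive, so a positive [G] has [G h]
    bounded in modulus by its value at [e0^(x)k]. With the hypothesis on [F], the [e1] and [e2]
    terms are then dominated by the [e0] term. *)
Lemma dual_min_tpow V (C : set V) (e0 e1 e2 : dual_space V) k g :
  (forall F, dual_cone (dual_cone C) F -> `|F e1| + `|F e2| <= F e0) ->
  correlators e1 e2 k g -> dual_cone (min_tpow C k) (tfun_pow e0 k + g).
Proof.
move=> e012; elim: k g => [|k IHk] g /=.
  case=> -> x x0; rewrite !(add_lfunE, opp_lfunE, id_lfunE).
    exact: addr_ge0.
  by rewrite subrr.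
move=> [g1 [g2 [Eg1 Eg2 ->]]] z zmin; rewrite !add_lfunE.
(* The functional at [z] is the pairing of [z] with [phi], so it suffices that [phi] lies in the
   maximal tensor product of the dual cones. *)
pose phi : tensor (dual_space V) (dual_space (tpow V k)) :=
  tpure e0 (tfun_pow e0 k) + (tpure e1 g1 + tpure e2 g2).
have := zmin phi; rewrite !linearD /= !tbidualE; apply.
move=> F G CF DG; rewrite !linearD /= !tfunE.
have Gle h : correlators e1 e2 k h -> `|G h| <= G (tfun_pow e0 k).
  move=> Eh; have := DG _ (IHk _ Eh); have := DG _ (IHk _ (correlatorsN Eh)).
  by rewrite ler_norml !linearD linearN /=; lra.
have := e012 _ CF; have := Gle _ Eg1; have := Gle _ Eg2.
have := ler_norm (- (F e1 * G g1)); have := ler_norm (- (F e2 * G g2)).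
rewrite !normrN !normrM.
have := normr_ge0 (F e1); have := normr_ge0 (F e2).
have := normr_ge0 (G g1); have := normr_ge0 (G g2).
nra.
Qed.

(* Real and imaginary parts of [(A + iB)^(x)k]. *)
Fixpoint tpow_Re_Im V (A B : V) (k : nat) : tpow V k * tpow V k :=
  match k return tpow V k * tpow V k with
  | 0 => (1 : R^o, 0 : R^o)
  | k'.+1 => let ri := tpow_Re_Im A B k' in
             (tpure A ri.1 - tpure B ri.2, tpure A ri.2 + tpure B ri.1)
  end.

Lemma tfun_tmap V W V' W' (P : 'Hom(V, V')) (Q : 'Hom(W, W'))
    (f : dual_space V') (g : dual_space W') v w :
  tfun f g (tmap P Q (tpure v w)) = f (P v) * g (Q w).
Proof. by rewrite tmapE tfunE. Qed.

Lemma tfun_pow_map V W (P : 'Hom(V, W)) (f : dual_space W) k A :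
  tfun_pow f k (tpow_map P k (tpow_pure k (fun=> A))) = f (P A) ^+ k.
Proof.
elim: k => [|k IHk] /=; first by rewrite !id_lfunE.
by rewrite tfun_tmap IHk exprS.
Qed.

(* For fixed [c], the optimal signs of [g] and [g'] make [Re (c * cv g)] and
   [Im (c * cv g')] the sums over [s] of [|Re (c w_(s 1) ... w_(s k))|] and
   [|Im (c w_(s 1) ... w_(s k))|]. *)
Lemma correlators_large V W (P : 'Hom(V, W)) (e1 e2 : dual_space W) A B k
    (w1 := e1 (P A) +i* e1 (P B)) (w2 := e2 (P A) +i* e2 (P B)) (c : R[i])
    (cv := fun g => g (tpow_map P k (tpow_Re_Im A B k).1) +i*
                    g (tpow_map P k (tpow_Re_Im A B k).2)) :
  exists g g', [/\ correlators e1 e2 k g, correlators e1 e2 k g' &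
    normc c * (normc w1 + normc w2) ^+ k
      <= complex.Re (c * cv g) + complex.Im (c * cv g')].
Proof.
rewrite {}/cv; elim: k c => [|k IHk] c /=.
  (* The zeroth power is [1 + 0 i]. Suitable signs make the right side [|Re c| + |Im c|], which is
     at least [normc c]. *)
  have sgn (x : R) : exists2 g : dual_space (R^o), (g = \1%VF \/ g = - \1%VF) &
      x * g 1 = `|x| /\ g 0 = 0.
    have [x0|x0] := ler0P x.
      exists (- \1%VF); first by right.
      by rewrite !opp_lfunE !id_lfunE mulrN mulr1 oppr0.
    by exists \1%VF; [left|rewrite !id_lfunE mulr1].
  have [g Eg [g1 g0]] := sgn (complex.Re c).
  have [g' Eg' [g'1 g'0]] := sgn (complex.Im c).
  exists g, g'; split=> //; rewrite !id_lfunE g0 g'0.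
  case: c g1 g'1 => a b /= g1 g'1; rewrite expr0 mulr1 !mulr0 subr0 add0r g1 g'1.
  rewrite -[leRHS]ger0_norm ?addr_ge0 // -sqrtr_sqr ler_wsqrtr //.
  rewrite sqrrD !real_normK ?num_real // lerD2r lerDl mulrn_wge0 //.
  by rewrite mulr_ge0.
(* The first factor of each product is absorbed into the constant; this is why [c] is general. *)
have [g1 [g1' [Eg1 Eg1' le1]]] := IHk (c * w1).
have [g2 [g2' [Eg2 Eg2' le2]]] := IHk (c * w2).
exists (tfun e1 g1 + tfun e2 g2), (tfun e1 g1' + tfun e2 g2').
split; [by exists g1, g2|by exists g1', g2'|].
rewrite !ComplexField.Normc.normcM in le1 le2.
have cvE h1 h2 : (tfun e1 h1 + tfun e2 h2) (tmap P (tpow_map P k)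
          (tpure A (tpow_Re_Im A B k).1 - tpure B (tpow_Re_Im A B k).2)) +i*
   (tfun e1 h1 + tfun e2 h2) (tmap P (tpow_map P k)
          (tpure A (tpow_Re_Im A B k).2 + tpure B (tpow_Re_Im A B k).1)) =
   w1 * (h1 (tpow_map P k (tpow_Re_Im A B k).1) +i*
                    h1 (tpow_map P k (tpow_Re_Im A B k).2)) +
   w2 * (h2 (tpow_map P k (tpow_Re_Im A B k).1) +i*
                    h2 (tpow_map P k (tpow_Re_Im A B k).2)).
  rewrite !add_lfunE !linearB !linearD /= !tfun_tmap; simpc.
  by congr (_ +i* _); ring.
rewrite !cvE !(mulrDr c) 2!raddfD addrACA !(mulrA c).
apply: le_trans (lerD le1 le2).
by rewrite exprS mulrA mulrDr mulrDl.
Qed.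

(** Evaluate [e0^(x)k - g] at the phase [(a, b)] and [e0^(x)k + g] at [(-a, -b)]. In the sum, the
    values of [g] at the pure powers and of [e0^(x)k] at the cross terms cancel. *)
Lemma powers_le (V W : vectType R) (P : 'Hom(V, W)) (C : set W)
    (D : forall k, set (tpow V k))
    (e0 e1 e2 : dual_space W) (X Y A B : V) k :
  (forall F, dual_cone (dual_cone C) F -> `|F e1| + `|F e2| <= F e0) ->
  (forall k, Pos (D k) (min_tpow C k) (tpow_map P k)) ->
  (forall a b : R, a ^+ 2 + b ^+ 2 = 1 ->
    D k (tpow_pure k (fun=> X) + tpow_pure k (fun=> Y) +
         (2 * a) *: (tpow_Re_Im A B k).1 + (2 * b) *: (tpow_Re_Im A B k).2)) ->
  (normc (e1 (P A) +i* e1 (P B)) +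
   normc (e2 (P A) +i* e2 (P B))) ^+ k <=
  e0 (P X) ^+ k + e0 (P Y) ^+ k.
Proof.
move=> e012 PD DXY.
have bound g a b : correlators e1 e2 k g -> a ^+ 2 + b ^+ 2 = 1 ->
   2 * (a * g (tpow_map P k (tpow_Re_Im A B k).1) +
        b * g (tpow_map P k (tpow_Re_Im A B k).2))
    <= e0 (P X) ^+ k + e0 (P Y) ^+ k.
  move=> Eg ab1.
  have := dual_min_tpow e012 Eg (PD _ _ (DXY (- a) (- b) _)).
  have := dual_min_tpow e012 (correlatorsN Eg) (PD _ _ (DXY a b ab1)).
  rewrite !(add_lfunE, opp_lfunE) !linearD !linearZ /= !tfun_pow_map !sqrrN.
  move=> h1 h2; have := h2 ab1; move: h1.
  rewrite /GRing.scale /=; lra.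
have [g [g' [Eg Eg']]] := correlators_large P e1 e2 A B k 1.
rewrite ComplexField.Normc.normc1 mul1r !mul1r /= => /le_trans; apply.
(* The phases 1 and [i] isolate the real and the imaginary part; each is at most half of the right
   side. *)
have := bound g 1 0 Eg; have := bound g' 0 1 Eg'.
rewrite !expr1n !expr0n /= addr0 add0r => /(_ erefl) h1 /(_ erefl) h2; lra.
Qed.
End TensorFunctionals.

(** * Hermitian operators on tensor powers and superpositions of product vectors *)

Section HermitianTensors.
Variable R : realType.
Local Notation C := R[i].
Local Notation I := ('i%R : C).

Lemma conj_real_complex (r : R) : Num.conj (r%:C : C) = r%:C.
Proof. exact: conjc_real. Qed.

Lemma hermx_trC n (A : her R n) : (hermx A)^t* = hermx A.
Proof. by case: A => A hA; exact: hermsymE. Qed.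

Lemma her_outer_subproof n (u : 'cV[C]_n) : u *m u^t* \is hermsymmx.
Proof. by apply: hermsymP; rewrite trmxC_mul trmxCK. Qed.
Definition her_outer n (u : 'cV[C]_n) : her R n := Her (her_outer_subproof u).

Lemma her_Re_subproof n (M : 'M[C]_n) : 2^-1 *: (M + M^t*) \is hermsymmx.
Proof.
by apply: hermsymP; rewrite trmxCZ trmxCD trmxCK fmorphV rmorph_nat addrC.
Qed.
(** The Hermitian component [H] in [M = H + i K], not the entrywise real part; [her_Im] is [K]. *)
Definition her_Re n (M : 'M[C]_n) : her R n := Her (her_Re_subproof M).

Lemma her_Im_subproof n (M : 'M[C]_n) :
  (2^-1 * - I) *: (M + (-1) *: M^t*) \is hermsymmx.
Proof.
apply: hermsymP; rewrite trmxCZ trmxCD trmxCZ trmxCK rmorphM !rmorphN fmorphV.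
rewrite rmorph_nat rmorph1 /= conjCi opprK !scaleN1r mulrN scaleNr -scalerN.
by rewrite opprB.
Qed.
Definition her_Im n (M : 'M[C]_n) : her R n := Her (her_Im_subproof M).

Lemma her_Re_Im n (M : 'M[C]_n) : hermx (her_Re M) + I *: hermx (her_Im M) = M.
Proof.
rewrite /= scalerA mulrN mulrN mulrCA -expr2 sqrCi mulrN1 opprK -scalerDr.
rewrite scaleN1r addrACA subrr addr0.
by rewrite -mulr2n -(scaler_nat 2 M) scalerA mulVf ?scale1r ?pnatr_eq0.
Qed.

(** The product vector [u^(x)k]; the type cast relies on [1 * 1] being convertible to 1. *)
Fixpoint tvec n (u : 'cV[C]_n) k : 'cV[C]_(hdim n k) :=
  match k return 'cV[C]_(hdim n k) with
  | 0 => 1%:M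
  | k'.+1 => (u *t tvec u k' : 'M_(n * hdim n k', 1 * 1))
  end.

Lemma tpow_her_tpure n k (A : her R n) (z : tpow (her R n) k) :
  tpow_her R n k.+1 (tpure A z) = hertens A (tpow_her R n k z).
Proof.
rewrite [LHS]/= tliftE // => [B|B].
  exact: hertens_linearl.
by move=> a x y; rewrite linearP hertens_linearr.
Qed.

Lemma tvec_outer n (u v : 'cV[C]_n) k :
  tvec u k.+1 *m (tvec v k.+1)^t* =
  (u *m v^t*) *t (tvec u k *m (tvec v k)^t*) :> 'M_(n * hdim n k).
Proof.
rewrite -tensmx_mul; congr (_ *m _).
by rewrite -map_mxT -trmx_tens.
Qed.

Lemma hermx_tpow_pure n (u : 'cV[C]_n) k :
  hermx (tpow_her R n k (tpow_pure k (fun=> her_outer u))) =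
  tvec u k *m (tvec u k)^t*.
Proof.
elim: k => [|k IHk].
  rewrite /= lfunE /= trmx1 map_mx1 mulmx1 /her1 /=.
  by congr (_%:M).
by rewrite tpow_her_tpure tvec_outer -IHk.
Qed.

(** Both sides are the [k]-th tensor power of [A + i B], which is [u v*] by hypothesis. *)
Lemma hermx_tpow_Re_Im n (A B : her R n) (u v : 'cV[C]_n) k :
  hermx A + I *: hermx B = u *m v^t* ->
  hermx (tpow_her R n k (tpow_Re_Im A B k).1) +
    I *: hermx (tpow_her R n k (tpow_Re_Im A B k).2) = tvec u k *m (tvec v k)^t*.
Proof.
move=> AB; elim: k => [|k IHk].
  rewrite /= linear0 lfunE /= trmx1 map_mx1 mulmx1 scaler0 addr0.
  by congr (_%:M).
have E1 : tpow_her R n k.+1 (tpow_Re_Im A B k.+1).1 =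
    hertens A (tpow_her R n k (tpow_Re_Im A B k).1) -
    hertens B (tpow_her R n k (tpow_Re_Im A B k).2).
  by rewrite -!tpow_her_tpure -linearB.
have E2 : tpow_her R n k.+1 (tpow_Re_Im A B k.+1).2 =
    hertens A (tpow_her R n k (tpow_Re_Im A B k).2) +
    hertens B (tpow_her R n k (tpow_Re_Im A B k).1).
  by rewrite -!tpow_her_tpure -linearD.
rewrite tvec_outer -IHk -AB E1 E2.
have -> (E F : her R (n * hdim n k)) : hermx (E - F) = hermx E - hermx F by [].
rewrite hermxD /=; apply/matrixP => i j; rewrite !mxE.
set a := hermx A _ _; set b := hermx B _ _.
set r := hermx _ _ _; set s := hermx _ _ _.
have ii : I * I = -1 by rewrite -expr2 sqrCi.
ring: ii.
Qed.

(** The operator is [z z*] for [z = u^(x)k + w v^(x)k] and [w = a + i b] of modulus 1: its two cross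
    terms are mutually adjoint and add up to the last two summands. *)
Lemma PSD_tpow_superposition n k (A B : her R n) (u v : 'cV[C]_n) (a b : R) :
  hermx A + I *: hermx B = u *m v^t* -> a ^+ 2 + b ^+ 2 = 1 ->
  PSD_tpow R n k (tpow_pure k (fun=> her_outer u) +
    tpow_pure k (fun=> her_outer v) +
    (2 * a) *: (tpow_Re_Im A B k).1 + (2 * b) *: (tpow_Re_Im A B k).2).
Proof.
move=> AB ab1 y.
have M := hermx_tpow_Re_Im k AB.
pose w : C := a%:C + I * b%:C.
have ww : w * Num.conj w = 1.
  rewrite /w rmorphD rmorphM /= !conj_real_complex conjCi.
  rewrite -[RHS](rmorph1 (real_complex R)) -ab1.
  rewrite rmorphD !rmorphXn /=.
  have ii : I * I = -1 by rewrite -expr2 sqrCi.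
  ring: ii.
pose z := tvec u k + w *: tvec v k.
have -> : hermx (tpow_her R n k
    (tpow_pure k (fun=> her_outer u) +
    tpow_pure k (fun=> her_outer v) +
    (2 * a) *: (tpow_Re_Im A B k).1 + (2 * b) *: (tpow_Re_Im A B k).2)) = z *m z^t*.
  rewrite ![in LHS]linearD ![in LHS]linearZ_LR !hermxD !hermxZ !hermx_tpow_pure.
  rewrite /z trmxCD trmxCZ mulmxDl !mulmxDr -!scalemxAr -!scalemxAl scalerA.
  have MC := congr1 (fun M : 'M[C]_(hdim n k) => M^t*) M.
  rewrite /= trmxCD trmxCZ !hermx_trC trmxC_mul trmxCK conjCi in MC.
  have wC : Num.conj w = a%:C - I * b%:C.
    by rewrite /w rmorphD rmorphM /= !conj_real_complex conjCi mulNr.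
  rewrite -MC -M [_ * w]mulrC ww scale1r wC /w !rmorphM /=.
  move: (tvec u k *m _) (tvec v k *m _) (hermx _) (hermx _) => U V E F.
  apply/matrixP => i j; rewrite !mxE.
  have -> : (2 : R)%:C = 2 by rewrite rmorph_nat.
  have ii : I * I = -1 by rewrite -expr2 sqrCi.
  ring: ii.
have -> : y^t* *m (z *m z^t*) *m y = (y^t* *m z) *m (y^t* *m z)^t*.
  by rewrite trmxC_mul trmxCK !mulmxA.
by rewrite mxE big_ord1 [X in _ * X]mxE [X in _ * X^*]mxE mul_conjC_ge0.
Qed.
End HermitianTensors.

(** * Real coordinates on Hermitian matrices *)

HB.instance Definition _ (R : realType) n :=
  GRing.isLinear.Build R (her R n) 'rV[R]_(n * n) _ (@her_to_rV R n)
    (@her_to_rV_linear R n).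

Section Coordinates.
Variables (R : realType) (n : nat).
Local Notation C := R[i].

Lemma sum_antisym (f : 'I_n -> 'I_n -> R) :
  (forall i j, f j i = - f i j) -> \sum_i \sum_j f i j = 0.
Proof.
move=> fN; set S := (LHS).
have : S = - S.
  rewrite {1}/S exchange_big /= -sumrN; apply: eq_bigr => i _.
  by rewrite -sumrN; apply: eq_bigr => j _.
by lra.
Qed.

(** Expanding [(a + b) (c + d)] entrywise, [a c + b d] gives the trace, while [a d + b c] is
    antisymmetric in the indices and sums to 0. *)
Lemma ip_her_to_rV (A B : her R n) :
  (ip (her_to_rV A) (her_to_rV B))%:C = \tr (hermx A *m hermx B).
Proof.
pose a i j := complex.Re (A i j); pose b i j := complex.Im (A i j).
pose c i j := complex.Re (B i j); pose d i j := complex.Im (B i j).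
have sym (E : her R n) i j : complex.Re (E j i) = complex.Re (E i j) /\
    complex.Im (E j i) = - complex.Im (E i j).
  by rewrite (herE E j i); case: (E i j).
have -> : ip (her_to_rV A) (her_to_rV B) =
    \sum_i \sum_j ((a i j * c i j + b i j * d i j) + (a i j * d i j + b i j * c i j)).
  rewrite /ip big_ord1 (reindex _ (curry_mxvec_bij n n)) pair_bigA /=.
  apply: eq_bigr => -[i j] _ /=; rewrite /her_to_rV !mxvecE !mxE.
  by rewrite /a /b /c /d; ring.
have -> : \tr (hermx A *m hermx B) =
    \sum_i \sum_j ((a i j * c i j + b i j * d i j) +i* (b i j * c i j - a i j * d i j)).
  apply: eq_bigr => i _; rewrite mxE; apply: eq_bigr => j _.
  rewrite (herE B j i) /a /b /c /d; case: (A i j) (B i j) => x y [z t] /=.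
  by simpc; congr (_ +i* _); ring.
under eq_bigr do rewrite big_split /=.
rewrite big_split /= [X in _ + X]sum_antisym ?addr0; last first.
  by move=> i j; rewrite /a /b /c /d !(sym _ i j).1 !(sym _ i j).2; ring.
have -> (F G : 'I_n -> 'I_n -> R) :
    \sum_i \sum_j (F i j +i* G i j) = (\sum_i \sum_j F i j) +i* (\sum_i \sum_j G i j).
  apply/eqP; rewrite eq_complex !raddf_sum /=; apply/andP.
  by split; apply/eqP; apply: eq_bigr => i _; rewrite raddf_sum.
rewrite [X in _ +i* X]sum_antisym //.
by move=> i j; rewrite /a /b /c /d !(sym _ i j).1 !(sym _ i j).2; ring.
Qed.

Lemma her_functionalE (f : dual_space (her R n)) :
  exists X : her R n, forall A, f A = ip (her_to_rV X) (her_to_rV A).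
Proof.
have [her_of rVK herK] := her_to_rV_bij R n.
have hofD r s a : her_of (a *: r + s) = a *: her_of r + her_of s.
  by apply: (can_inj rVK); rewrite her_to_rV_linear !herK.
pose gl := GRing.isLinear.Build R _ _ _ her_of (fun a r s => hofD r s a).
pose g : {linear 'rV[R]_(n * n) -> her R n} := HB.pack her_of gl.
exists (her_of (\row_k f (her_of (delta_mx 0 k)))) => A.
rewrite herK /ip big_ord1 -{1}(rVK A) {1}[her_to_rV A]row_sum_delta.
rewrite -[her_of _]/(g _) !linear_sum; apply: eq_bigr => k _.
by rewrite !linearZ !mxE mulrC.
Qed.
End Coordinates.

(** * Scalar inequalities that remove the exponent and the scaling *)

Section PowerInequalities.
Variable R : realType.

Lemma le_max_of_powers (q a b : R) : 0 <= a -> 0 <= b ->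
  (forall k, q ^+ k <= a ^+ k + b ^+ k) -> q <= Num.max a b.
Proof.
move=> a0 b0 H; set m := Num.max a b; rewrite leNgt; apply/negP => mq.
have am : a <= m by rewrite le_max lexx.
have bm : b <= m by rewrite le_max lexx orbT.
have m0 : 0 <= m by exact: le_trans am.
have H2 k : q ^+ k <= 2 * m ^+ k.
  by apply: (le_trans (H k)); rewrite mulr_natl mulr2n lerD // lerXn2r.
have mp : 0 < m.
  rewrite lt_def m0 andbT; apply/eqP => mE.
  by move: mq; have := H2 1; rewrite mE !expr1; lra.
(* Bernoulli's inequality for [q / m], cleared of denominators; it contradicts
   [q ^+ k <= 2 * m ^+ k] for large [k]. *)
have bern k : m ^+ k * (m + k%:R * (q - m)) <= q ^+ k * m.
  elim: k => [|k IHk]; first by rewrite !expr0 mul0r addr0.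
  have q0 : 0 <= q by lra.
  rewrite !exprS -mulrA -(mulrA q); apply: le_trans (ler_wpM2l q0 IHk).
  rewrite mulrCA -[in leRHS]mulrCA; apply: ler_wpM2l; first exact: exprn_ge0.
  rewrite -natr1; have : 0 <= k%:R * (q - m) ^+ 2 by rewrite mulr_ge0 ?sqr_ge0.
  by nra.
pose k := Num.bound (m / (q - m)).
have mk : m < k%:R * (q - m).
  rewrite -ltr_pdivrMr ?subr_gt0 //; apply: archi_boundP.
  by rewrite divr_ge0 // subr_ge0 ltW.
have := le_trans (bern k) (ler_wpM2r m0 (H2 k)).
rewrite mulrAC (mulrC _ (m ^+ k)) ler_pM2l ?exprn_gt0 //; lra.
Qed.

Lemma le_mean_of_rescaled (q a b : R) : 0 <= a -> 0 <= b ->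
  (forall t, 0 < t -> q <= Num.max (t * a) (t^-1 * b)) -> q *+ 2 <= a + b.
Proof.
move=> a0 b0 H; rewrite leNgt; apply/negP => abq.
(* [p] lies strictly between the mean and [q]. For [t = (2 p - a) / p], [t a <= p] follows from
   [(p - a)^2 >= 0] and [t^-1 b < p] from [b < 2 p - a]; this choice also covers vanishing [a] or
   [b]. *)
pose p := (q + (a + b) / 2) / 2.
have [p0 pq pab] : [/\ 0 < p, p < q & a + b < 2 * p].
  by rewrite /p; split; lra.
have t0 : 0 < 2 * p - a by lra.
have := H ((2 * p - a) / p); rewrite divr_gt0 // => /(_ isT).
have pp : p * p < q * p by rewrite ltr_pM2r.
have qp : p * (2 * p - a) < q * (2 * p - a) by rewrite ltr_pM2r.
have pb : p * b < p * (2 * p - a) by rewrite ltr_pM2l //; lra.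
rewrite le_max => /orP[].
  by rewrite mulrAC ler_pdivlMr // => h; have := sqr_ge0 (p - a); nra.
by rewrite invf_div mulrAC ler_pdivlMr // => h; nra.
Qed.
End PowerInequalities.

(** * The bidual of the square cone *)

Section SquareCone.
Variable R : realType.

Definition entry (j : 'I_3) (v : 'rV[R]_3) : R^o := v 0 j.

Lemma entry_is_linear j : linear (entry j).
Proof. by move=> a x y; rewrite /entry !mxE. Qed.
HB.instance Definition _ j :=
  GRing.isLinear.Build R 'rV[R]_3 R^o _ (entry j) (entry_is_linear j).

Definition coordf (j : 'I_3) : dual_space 'rV[R]_3 := linfun (entry j).

Lemma coordfE j v : coordf j v = v 0 j.
Proof. by rewrite lfunE. Qed.

(** The functionals [coordf 0 + s coordf 1 + t coordf 2] with [s], [t] in [[-1, 1]] are positive on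
    the cone; the four sign choices give the bound, which is what [dual_min_tpow] asks for. *)
Lemma square_cone_bidual F : dual_cone (dual_cone (square_cone R)) F ->
  `|F (coordf 1)| + `|F (coordf 2%:R)| <= F (coordf 0).
Proof.
move=> CF.
have H (s t : R) : `|s| <= 1 -> `|t| <= 1 ->
    0 <= F (coordf 0) + s * F (coordf 1) + t * F (coordf 2%:R).
  move=> s1 t1; have := CF (coordf 0 + s *: coordf 1 + t *: coordf 2%:R).
  rewrite !linearD !linearZ /=; apply => x Cx.
  rewrite !add_lfunE !scale_lfunE !coordfE.
  have hs : `|s * x 0 1| <= `|x 0 1| by rewrite normrM ler_piMl.
  have ht : `|t * x 0 2%:R| <= `|x 0 2%:R| by rewrite normrM ler_piMl.
  have := ler_norm (- (s * x 0 1)); have := ler_norm (- (t * x 0 2%:R)).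
  rewrite !normrN; move: Cx; rewrite /square_cone /= /GRing.scale /=; lra.
have n1 : `|1 : R| <= 1 by rewrite normr1.
have nN1 : `|-1 : R| <= 1 by rewrite normrN1.
have := H _ _ n1 n1; have := H _ _ n1 nN1.
have := H _ _ nN1 n1; have := H _ _ nN1 nN1.
case: (ler0P (F (coordf 1))); case: (ler0P (F (coordf 2%:R))); lra.
Qed.
End SquareCone.

(** * Inequality (1) for tensor-stable positive maps *)

Section TensorStable.
Variables (R : realType) (n : nat) (P : 'Hom(her R n, 'rV[R]_3)).
Local Notation C := R[i].
Variable P_pos : Pos (PSD R n) (square_cone R) P.
Variable P_tpow : forall k : nat,
  Pos (PSD_tpow R n k) (min_tpow (square_cone R) k) (tpow_map P k).

Lemma PSD_her_outer (u : 'cV[C]_n) : PSD R n (her_outer u).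
Proof.
move=> v; have -> : v^t* *m her_outer u *m v = (v^t* *m u) *m (v^t* *m u)^t*.
  by rewrite /= trmxC_mul trmxCK !mulmxA.
by rewrite mxE big_ord1 [X in _ * X]mxE [X in _ * X^*]mxE mul_conjC_ge0.
Qed.

Lemma her_outerZ (t : R) (u : 'cV[C]_n) : 0 <= t ->
  her_outer ((Num.sqrt t)%:C *: u) = t *: her_outer u.
Proof.
move=> t0; apply: val_inj; rewrite /= trmxCZ conj_real_complex.
by rewrite -scalemxAr -scalemxAl scalerA -rmorphM -expr2 sqr_sqrtr.
Qed.

Lemma coord0_outer_ge0 u : 0 <= (P (her_outer u)) 0 0.
Proof.
have := P_pos (PSD_her_outer u); rewrite /square_cone /=.
by apply: le_trans; rewrite addr_ge0.
Qed.

(** Scaling [u] by [sqrt t] and [v] by its inverse fixes [u v*], hence [w], and multiplies the two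
    terms on the right by [t] and [t^-1]. *)
Lemma offdiag_functional_le (u v : 'cV[C]_n)
    (w := fun j => (P (her_Re (u *m v^t*))) 0 j +i* (P (her_Im (u *m v^t*))) 0 j) :
  (normc (w 1) + normc (w 2%:R)) *+ 2 <=
  (P (her_outer u)) 0 0 + (P (her_outer v)) 0 0.
Proof.
apply: le_mean_of_rescaled; rewrite ?coord0_outer_ge0 // => t t0.
have ti0 : 0 < t^-1 by rewrite invr_gt0.
pose u' := (Num.sqrt t)%:C *: u; pose v' := (Num.sqrt t^-1)%:C *: v.
have uv : u' *m v'^t* = u *m v^t*.
  rewrite /u' /v' trmxCZ conj_real_complex -scalemxAr -scalemxAl scalerA.
  by rewrite -rmorphM sqrtrV ?ltW // mulVf ?rmorph1 ?scale1r // sqrtr_eq0 -ltNge.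
have Pu : (P (her_outer u')) 0 0 = t * (P (her_outer u)) 0 0.
  by rewrite her_outerZ ?ltW // linearZ mxE.
have Pv : (P (her_outer v')) 0 0 = t^-1 * (P (her_outer v)) 0 0.
  by rewrite her_outerZ ?ltW // linearZ mxE.
rewrite -Pu -Pv; apply: le_max_of_powers; rewrite ?coord0_outer_ge0 // => k.
have := @powers_le R _ _ P (square_cone R) (@PSD_tpow R n) (coordf R 0) (coordf R 1)
  (coordf R 2%:R) (her_outer u') (her_outer v')
  (her_Re (u *m v^t*)) (her_Im (u *m v^t*)) k
  (@square_cone_bidual R) P_tpow.
rewrite !coordfE; apply => a b ab.
by apply: PSD_tpow_superposition ab; rewrite her_Re_Im uv.
Qed.

(** The form [v* X_j u] is the value at [u v*] of the complex-linear extension of the [j]-th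
    coordinate of [P]. *)
Lemma tensor_stable_offdiag_dominated (X : 'I_3 -> her R n) :
  (forall j A, (P A) 0 j = ip (her_to_rV (X j)) (her_to_rV A)) ->
  offdiag_dominated (hermx (X 0)) (hermx (X 1)) (hermx (X 2%:R)).
Proof.
move=> XE u v.
have trE j A : \tr (X j *m hermx A) = ((P A) 0 j)%:C by rewrite XE ip_her_to_rV.
have q0 x : qform (X 0) x x = ((P (her_outer x)) 0 0)%:C.
  by rewrite qform_tr -trE.
have q1 j : qform (X j) v u =
    (P (her_Re (u *m v^t*))) 0 j +i* (P (her_Im (u *m v^t*))) 0 j.
  rewrite qform_tr; have := her_Re_Im (u *m v^t*).
  move: (her_Re _) (her_Im _) => A B <-.
  by rewrite mulmxDr mxtraceD -scalemxAr mxtraceZ !trE -complexiE; simpc.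
rewrite !q0 !q1 -!rmorphD -rmorphMn lecR.
exact: offdiag_functional_le.
Qed.
End TensorStable.

(** * Separation from the entanglement-breaking maps *)

Section Separation.
Variables (R : realType) (n : nat).
Local Notation C := R[i].

Lemma sum_ord3 (V : nmodType) (f : 'I_3 -> V) :
  \sum_j f j = f 0 + f 1 + f 2%:R.
Proof.
rewrite !big_ord_recl big_ord0 addr0 addrA.
have -> : lift ord0 ord0 = 1 :> 'I_3 by exact: val_inj.
by have -> : lift ord0 (lift ord0 ord0) = 2%:R :> 'I_3 by exact: val_inj.
Qed.

Definition PSD_rV : set 'rV[R]_(n * n) := [set her_to_rV A | A in PSD R n].

Lemma her_sqr_subproof (A : her R n) : hermx A *m hermx A \is hermsymmx.
Proof. by apply: hermsymP; rewrite trmxC_mul !hermx_trC. Qed.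
Definition her_sqr (A : her R n) : her R n := Her (her_sqr_subproof A).

Lemma her_id_subproof : (1%:M : 'M[C]_n) \is hermsymmx.
Proof. by apply: hermsymP; rewrite trmx1 map_mx1. Qed.
Definition her_id : her R n := Her her_id_subproof.

Lemma PSD_her_sqrZ (a : R) (A : her R n) : 0 <= a -> PSD R n (a *: her_sqr A).
Proof.
move=> a0 v; rewrite hermxZ -scalemxAr -scalemxAl mxE.
apply: mulr_ge0; first by rewrite ler0c.
have -> : v^t* *m her_sqr A *m v = (hermx A *m v)^t* *m (hermx A *m v).
  by rewrite trmxC_mul hermx_trC /= !mulmxA.
rewrite mxE; apply: sumr_ge0 => i _; rewrite [X in X * _]mxE [X in X^* * _]mxE.
by rewrite mulrC mul_conjC_ge0.
Qed.

(** Polarization: [A] is a quarter of [(A + 1)^2 - (A - 1)^2]. *)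
Lemma PSD_rV_generating r :
  exists p q, [/\ PSD_rV p, PSD_rV q & r = p - q].
Proof.
have [her_of rVK herK] := her_to_rV_bij R n.
pose A := her_of r.
have q0 : (0 : R) <= 4^-1 by rewrite invr_ge0.
exists (her_to_rV (4^-1 *: her_sqr (A + her_id))),
  (her_to_rV (4^-1 *: her_sqr (A - her_id))).
split.
- by exists (4^-1 *: her_sqr (A + her_id)) => //; exact: PSD_her_sqrZ.
- by exists (4^-1 *: her_sqr (A - her_id)) => //; exact: PSD_her_sqrZ.
rewrite -linearB -scalerBr -[LHS]herK; congr her_to_rV; apply: val_inj => /=.
rewrite -/A !mulmxDl !mulmxDr !mulNmx !mulmxN !mul1mx !mulmx1 opprK.
apply/matrixP => i j; rewrite !mxE -[LHS]mul1r.
set x := hermx A i j; set y := \sum_k _.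
have -> : (4^-1 : R)%:C = (4 : C)^-1 by rewrite fmorphV rmorph_nat.
by field.
Qed.

Definition rV_pairing (r : 'rV[R]_(n * n)) (A : her R n) : R^o :=
  ip r (her_to_rV A).

Lemma rV_pairing_is_linear r : linear (rV_pairing r).
Proof. by move=> a A B; rewrite /rV_pairing linearP ipDr ipZr. Qed.
HB.instance Definition _ r :=
  GRing.isLinear.Build R (her R n) R^o _ (rV_pairing r) (rV_pairing_is_linear r).

Lemma ip_outer (A : her R n) v :
  (ip (her_to_rV A) (her_to_rV (her_outer v)))%:C = qform (hermx A) v v.
Proof. by rewrite ip_her_to_rV qform_tr. Qed.

Lemma EB_or_separated (P : 'Hom(her R n, 'rV[R]_3)) (X : 'I_3 -> her R n) :
  (forall j A, (P A) 0 j = ip (her_to_rV (X j)) (her_to_rV A)) ->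
  EB (PSD R n) (square_cone R) P \/
  exists Z : 'I_3 -> her R n,
    \sum_j ip (her_to_rV (X j)) (her_to_rV (Z j)) < 0 /\
    forall j, j != 0 -> PSD R n (Z 0 + Z j) /\ PSD R n (Z 0 - Z j).
Proof.
move=> XE; have [her_of rVK herK] := her_to_rV_bij R n.
(* The columns generate the four extreme rays of the square cone. A solution [s] pairs each ray with
   a positive functional, while a separating [Z] is tested ray by ray. *)
pose Phi : 'M[R]_(3, 4) := \matrix_(j, i)
  nth 0 (nth [::] [:: [:: 1; 1; 1; 1]; [:: 1; -1; 0; 0]; [:: 0; 0; 1; -1]] j) i.
have Phi0 i : Phi 0 i = 1.
  by rewrite mxE; case: i => -[|[|[|[|]]]].
have [[s Ks xE]|[Z Zneg Zpos]] := farkas_dual_rows (\matrix_j her_to_rV (X j))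
  PSD_rV_generating Phi0.
- left.
  exists 4, (fun i => linfun (rV_pairing (row i s))), (fun i => (col i Phi)^T).
  split=> [i|v].
    split=> [A PSDA|]; first by rewrite lfunE; apply: Ks; exists A.
    rewrite /square_cone /= !mxE; case: i => -[|[|[|[|]]]] //= _;
      by rewrite ?normr0 ?normrN1 ?normr1 ?addr0 ?add0r.
  apply/rowP => j; rewrite XE summxE.
  have -> : her_to_rV (X j) = row j (Phi *m s) by rewrite -xE rowK.
  rewrite row_mul mulmx_sum_row.
  rewrite -[LHS]/(\sum_i _) big_ord1; under eq_bigr do rewrite summxE mulr_suml.
  rewrite exchange_big; apply: eq_bigr => i _; rewrite lfunE /= !mxE.
  rewrite /rV_pairing /ip big_ord1 mulr_suml; apply: eq_bigr => k _.
  by rewrite !mxE; ring.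
right; exists (fun j => her_of (row j Z)); split.
  suff -> : \sum_j ip (her_to_rV (X j)) (her_to_rV (her_of (row j Z)))
     = ip Z (\matrix_j her_to_rV (X j)) by [].
  rewrite [RHS]ipC; apply: eq_bigr => j _; rewrite herK /ip big_ord1.
  by apply: eq_bigr => k _; rewrite !mxE.
have ZPhi i : PSD R n (\sum_j Phi j i *: her_of (row j Z)).
  move=> v; rewrite -[X in 0 <= X]/(qform _ _ _) -ip_outer ler0c linear_sum /=.
  pose t := her_to_rV (her_outer v).
  (* All rows but row [i] vanish, so pairing with [Z] isolates column [i] of [Phi]. *)
  pose s : 'M[R]_(4, n * n) := \matrix_i' (t *+ (i' == i)).
  suff -> : ip (\sum_j her_to_rV (Phi j i *: her_of (row j Z))) t = ip Z (Phi *m s).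
    apply: Zpos => i' _ [A PSDA <-]; rewrite rowK.
    case: (i' == i); last by rewrite mulr0n -(scale0r t) ipZl mul0r.
    rewrite ipC -ler0c ip_outer; exact: PSDA.
  have sE j : (Phi *m s) j = fun k => Phi j i * t 0 k.
    apply/funext => k; rewrite mxE (bigD1 i) //= big1 ?addr0 => [|i' /negPf i'i].
      by rewrite [X in _ * X]mxE eqxx.
    by rewrite [X in _ * X]mxE i'i mulr0n [X in _ * X]mxE mulr0.
  rewrite {1}/ip big_ord1.
  under eq_bigr do rewrite summxE mulr_suml.
  rewrite exchange_big; apply: eq_bigr => j _; apply: eq_bigr => k _.
  by rewrite sE linearZ /= herK !mxE; ring.
have sumE (F : 'I_3 -> her R n) i : \sum_j Phi j i *: F j =
    F 0 + Phi 1 i *: F 1 + Phi 2%:R i *: F 2%:R.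
  by rewrite sum_ord3 Phi0 scale1r.
move=> j j0; have [->|->] : j = 1 \/ j = 2%:R.
  by case: j j0 => -[|[|[|]]] // lt _; [left|right]; apply: val_inj.
  split; [have := ZPhi 0|have := ZPhi 1]; rewrite sumE !mxE /=;
    by rewrite ?scaleN1r ?scale1r scale0r addr0.
split; [have := ZPhi 2%:R|have := ZPhi 3%:R]; rewrite sumE !mxE /=;
  by rewrite ?scaleN1r ?scale1r scale0r addr0.
Qed.
End Separation.

(** * Conclusion by contradiction with a separating triple *)

Lemma tensor_stable_EB (R : realType) n (P : 'Hom(her R n, 'rV[R]_3)) :
  Pos (PSD R n) (square_cone R) P ->
  (forall k : nat,
     Pos (PSD_tpow R n k) (min_tpow (square_cone R) k) (tpow_map P k)) ->
  EB (PSD R n) (square_cone R) P.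
Proof.
move=> P_pos P_tpow.
have /choice[X XE'] j : exists X : her R n,
    forall A, (P A) 0 j = ip (her_to_rV X) (her_to_rV A).
  have [X XE] := her_functionalE (coordf R j \o P)%VF.
  by exists X => A; rewrite -XE comp_lfunE coordfE.
have [//|[Z [Zneg Zpos]]] := EB_or_separated XE'.
have [p1 m1] := Zpos 1 isT; have [p2 m2] := Zpos 2%:R isT.
suff : 0 <= \sum_j ip (her_to_rV (X j)) (her_to_rV (Z j)) by lra.
(* Adding [t] times the identity makes [Z 0] positive definite and changes the sum by [t] times the
   trace of [X 0]. *)
apply: (@nonneg_limit _ _ (ip (her_to_rV (X 0)) (her_to_rV (her_id R n))))
  => t /andP[t0 _].
pose Z0 := Z 0 + t *: her_id R n.
have qZ0 (Y : her R n) v : qform (hermx (Z0 + Y)) v v =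
    qform (hermx (Z 0 + Y)) v v + t%:C * qform 1%:M v v.
  rewrite /Z0 addrAC (hermxD (Z 0 + Y)) hermxZ /qform mulmxDr mulmxDl mxE.
  by rewrite -scalemxAr -scalemxAl [X in _ + X]mxE.
have q1 (v : 'cV[R[i]]_n) : qform 1%:M v v = \sum_i `|v i 0| ^+ 2.
  rewrite /qform mulmx1 mxE; apply: eq_bigr => i _.
  by rewrite normCKC [X in X * _]mxE [X in X^* * _]mxE.
have q1_ge0 (v : 'cV[R[i]]_n) : 0 <= t%:C * qform 1%:M v v.
  apply: mulr_ge0; first by rewrite ler0c ltW.
  by rewrite q1; apply: sumr_ge0 => i _; rewrite exprn_ge0.
have psd Y : PSD R n (Z 0 + Y) -> psdmx (hermx Z0 + hermx Y).
  by move=> h v; rewrite -hermxD qZ0 addr_ge0 //; exact: h.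
have pZ0 v : v != 0 -> 0 < qform (hermx Z0) v v.
  move=> v0; rewrite -[Z0]addr0 qZ0 ltr_wpDl //.
    rewrite addr0 -(@pmulrn_lge0 _ _ 2) //.
    have -> : qform (hermx (Z 0)) v v *+ 2 =
        qform (hermx (Z 0 + Z 1)) v v + qform (hermx (Z 0 - Z 1)) v v.
      by rewrite -qformD -hermxD addrACA subrr addr0 hermxD qformD mulr2n.
    by apply: addr_ge0; [exact: p1|exact: m1].
  rewrite mulr_gt0 ?ltcR // q1 lt_def sumr_ge0 ?andbT => [|i _]; last exact: exprn_ge0.
  apply: contra_neq v0 => /eqP; rewrite psumr_eq0 => [/allP v0|i _]; last exact: exprn_ge0.
  apply/colP => i; apply/eqP; have := v0 i (mem_index_enum _).
  by rewrite sqrf_eq0 normr_eq0 mxE.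
have herm (A : her R n) : hermx A \is hermsymmx by case: A.
have := offdiag_dominated_trace_ge0 (herm _) (herm _) (herm _)
  (tensor_stable_offdiag_dominated P_pos P_tpow XE') (herm Z0) pZ0
  (psd _ p1) (psd _ m1) (psd _ p2) (psd _ m2).
rewrite -!ip_her_to_rV -!rmorphD -complexRe lecR /=.
rewrite sum_ord3 /Z0 linearD linearZ /= ipDr ipZr; lra.
Qed.

Theorem theorem26 (R : realType) (P : 'Hom(her R 3, 'rV[R]_3)) :
  Pos (PSD R 3) (square_cone R) P ->
  (forall k : nat,
     Pos (PSD_tpow R 3 k) (min_tpow (square_cone R) k) (tpow_map P k)) ->
  EB (PSD R 3) (square_cone R) P.
Proof. exact: tensor_stable_EB. Qed.
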